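(* Consider Problem (P) under Assumptions A1–A6 and B1–B2, with surrogates $\widetilde f_i$ satisfying F1–F3. Let $\{\mathbf{x}[n]\}_n=\{(\mathbf{x}_i[n])_{i=1}^I\}_n$ be generated by the inexact NEXT iteration with tolerances $\varepsilon_i[n]\ge0$ (a bounded sequence for each $i$), and let $\overline{\mathbf{x}}[n]=\frac1I\sum_i\mathbf{x}_i[n]$. Suppose $\alpha[n]\in(0,1]$ for all $n$, $\sum_n\alpha[n]=\infty$, $\sum_n\alpha[n]^2<\infty$, and $\sum_{n=0}^\infty\alpha[n]\varepsilon_i[n]<\infty$ for all $i$. Then (a) $\{\overline{\mathbf{x}}[n]\}_n$ is bounded and all its limit points are stationary solutions of (P); (b) $\|\mathbf{x}_i[n]-\overline{\mathbf{x}}[n]\|\to0$ for all $i$.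
   Context: Problem (P): minimize $U(\mathbf{x})=F(\mathbf{x})+G(\mathbf{x})$ subject to $\mathbf{x}\in\mathcal K\subseteq\mathbb R^m$, where $F=\sum_{i=1}^I f_i$. Assumptions: (A1) $\mathcal K$ nonempty, closed, convex; (A2) each $f_i:\mathbb R^m\to\mathbb R$ is $C^1$ (possibly nonconvex) on an open set containing $\mathcal K$; (A3) each $\nabla f_i$ is Lipschitz on $\mathcal K$ with constant $L_i$; (A4) $\|\nabla F(\mathbf{x})\|\le L_F$ on $\mathcal K$ for some finite $L_F$; (A5) $G$ is convex (possibly nonsmooth) with all subgradients on $\mathcal K$ bounded in norm by some finite $L_G$; (A6) $U$ is coercive on $\mathcal K$. A point $\mathbf{x}^*\in\mathcal K$ is a stationary solution of (P) if there is a subgradient $\boldsymbol\xi\in\partial G(\mathbf{x}^* )$ with $(\nabla F(\mathbf{x}^* )+\boldsymbol\xi)^T(\mathbf{y}-\mathbf{x}^* )\ge0$ for all $\mathbf{y}\in\mathcal K$. Network: at each time $n$ a digraph $\mathcal G[n]=(\{1,\dots,I\},\mathcal E[n])$; $\mathcal N_i^{\rm in}[n]=\{j:(j,i)\in\mathcal E[n]\}\cup\{i\}$. Weights: $w_{ij}[n]=\theta_{ij}\in[\vartheta,1]$ if $j\in\mathcal N_i^{\rm in}[n]$ and $w_{ij}[n]=0$ otherwise, for a fixed $\vartheta\in(0,1)$; $\mathbf W[n]=(w_{ij}[n])$. (B1) there is an integer $B>0$ such that for every $k\ge0$ the graph with edge set $\bigcup_{n=kB}^{(k+1)B-1}\mathcal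 E[n]$ is strongly connected; (B2) $\mathbf W[n]\mathbf 1=\mathbf 1$ and $\mathbf 1^T\mathbf W[n]=\mathbf 1^T$ for all $n$. Surrogates $\widetilde f_i(\cdot;\mathbf{x}):\mathcal K\to\mathbb R$ (differentiable in the first argument) satisfy: (F1) $\widetilde f_i(\cdot;\mathbf{x})$ is strongly convex on $\mathcal K$ with constant $\tau_i>0$ uniformly in $\mathbf{x}\in\mathcal K$; (F2) $\nabla\widetilde f_i(\mathbf{x};\mathbf{x})=\nabla f_i(\mathbf{x})$ for all $\mathbf{x}\in\mathcal K$ (gradient w.r.t. the first argument); (F3) $\nabla\widetilde f_i(\mathbf{x};\cdot)$ is Lipschitz on $\mathcal K$ uniformly in $\mathbf{x}\in\mathcal K$. NEXT iteration (inexact version; the exact version has $\varepsilon_i[n]=0$): initialize $\mathbf{x}_i[0]\in\mathcal K$, $\mathbf y_i[0]=\nabla f_i(\mathbf{x}_i[0])$, $\widetilde{\boldsymbol\pi}_i[0]=I\mathbf y_i[0]-\nabla f_i(\mathbf{x}_i[0])$. For $n\ge0$ each agent $i$: computes $\widetilde{\mathbf{x}}_i[n]=\arg\min_{\mathbf{x}\in\mathcal K}\{\widetilde f_i(\mathbf{x};\mathbf{x}_i[n])+\widetilde{\boldsymbol\pi}_i[n]^T(\mathbf{x}-\mathbf{x}_i[n])+G(\mathbf{x})\}$; picks $\mathbf{x}_i^{\rm inx}[n]\in\mathcal K$ with $\|\mathbf{x}_i^{\rm inx}[n]-\widetilde{\mathbf{x}}_i[n]\|\le\varepsilon_i[n]$;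 sets $\mathbf z_i[n]=\mathbf{x}_i[n]+\alpha[n](\mathbf{x}_i^{\rm inx}[n]-\mathbf{x}_i[n])$; then $\mathbf{x}_i[n+1]=\sum_{j=1}^I w_{ij}[n]\mathbf z_j[n]$, $\mathbf y_i[n+1]=\sum_{j=1}^I w_{ij}[n]\mathbf y_j[n]+\nabla f_i(\mathbf{x}_i[n+1])-\nabla f_i(\mathbf{x}_i[n])$, $\widetilde{\boldsymbol\pi}_i[n+1]=I\mathbf y_i[n+1]-\nabla f_i(\mathbf{x}_i[n+1])$. *)

(* Defs.v *)
From Stdlib Require Import Reals Relations.
From mathcomp Require Import all_boot.
Set Implicit Arguments. Unset Strict Implicit.
Open Scope R_scope.

Definition vec (m : nat) := 'I_m -> R.
Definition vzero {m} : vec m := fun _ => 0.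
Definition vadd {m} (u v : vec m) : vec m := fun k => u k + v k.
Definition vsub {m} (u v : vec m) : vec m := fun k => u k - v k.
Definition vscal {m} (a : R) (u : vec m) : vec m := fun k => a * u k.
Definition vdot {m} (u v : vec m) : R := \big[Rplus/0]_(k < m) (u k * v k).
Definition vnorm {m} (u : vec m) : R := sqrt (vdot u u).
Definition vsumI {n m} (F : 'I_n -> vec m) : vec m :=
  fun k => \big[Rplus/0]_(j < n) F j k.
Definition rsumI {n} (F : 'I_n -> R) : R := \big[Rplus/0]_(j < n) F j.

Definition vconv {m} (u : nat -> vec m) (x : vec m) : Prop :=
  Un_cv (fun n => vnorm (vsub (u n) x)) 0.
Definition vnonempty_set {m} (K : vec m -> Prop) := exists x, K x.
Definition vclosed_set {m} (K : vec m -> Prop) :=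
  forall (u : nat -> vec m) x, (forall n, K (u n)) -> vconv u x -> K x.
Definition vopen_set {m} (O : vec m -> Prop) :=
  forall x, O x -> exists r, 0 < r /\ forall y, vnorm (vsub y x) < r -> O y.
Definition vconvex_set {m} (K : vec m -> Prop) :=
  forall x y t, K x -> K y -> 0 <= t <= 1 ->
    K (vadd (vscal t x) (vscal (1 - t) y)).

Definition vconvex_fun {m} (G : vec m -> R) :=
  forall x y t, 0 <= t <= 1 ->
    G (vadd (vscal t x) (vscal (1 - t) y)) <= t * G x + (1 - t) * G y.
Definition strongly_convex_on {m} (K : vec m -> Prop) (tau : R) (f : vec m -> R) :=
  forall x y t, K x -> K y -> 0 <= t <= 1 ->
    f (vadd (vscal t x) (vscal (1 - t) y))
      <= t * f x + (1 - t) * f y - tau / 2 * t * (1 - t) * (vnorm (vsub x y)) ^ 2.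
Definition subgrad {m} (G : vec m -> R) (x xi : vec m) :=
  forall y, G x + vdot xi (vsub y x) <= G y.
Definition has_grad {m} (f : vec m -> R) (g x : vec m) :=
  forall eps, 0 < eps -> exists d, 0 < d /\ forall y, vnorm (vsub y x) < d ->
    Rabs (f y - f x - vdot g (vsub y x)) <= eps * vnorm (vsub y x).
(* gradient relative to a set K (for functions only defined on K) *)
Definition has_grad_rel {m} (K : vec m -> Prop) (f : vec m -> R) (g x : vec m) :=
  forall eps, 0 < eps -> exists d, 0 < d /\ forall y, K y -> vnorm (vsub y x) < d ->
    Rabs (f y - f x - vdot g (vsub y x)) <= eps * vnorm (vsub y x).
Definition vcontinuous_on {m} (O : vec m -> Prop) (g : vec m -> vec m) :=
  forall x, O x -> forall eps, 0 < eps -> exists d, 0 < d /\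
    forall y, O y -> vnorm (vsub y x) < d -> vnorm (vsub (g y) (g x)) < eps.
Definition C1_near {m} (K : vec m -> Prop) (f : vec m -> R) (gradf : vec m -> vec m) :=
  exists O : vec m -> Prop, vopen_set O /\ (forall x, K x -> O x) /\
    (forall x, O x -> has_grad f (gradf x) x) /\ vcontinuous_on O gradf.
Definition lipschitz_on {m} (K : vec m -> Prop) (L : R) (g : vec m -> vec m) :=
  forall x y, K x -> K y -> vnorm (vsub (g x) (g y)) <= L * vnorm (vsub x y).
Definition coercive_on {m} (K : vec m -> Prop) (U : vec m -> R) :=
  forall M, exists r, forall x, K x -> r <= vnorm x -> M <= U x.

Definition stationary {m} (K : vec m -> Prop) (gradF : vec m -> vec m)
    (G : vec m -> R) (x : vec m) :=
  K x /\ exists xi, subgrad G x xi /\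
    forall y, K y -> 0 <= vdot (vadd (gradF x) xi) (vsub y x).

(* graphs on agents 'I_I; E j i means the edge (j,i) *)
Definition strongly_connected {I} (E : 'I_I -> 'I_I -> Prop) :=
  forall i j : 'I_I, clos_refl_trans _ E i j.
Definition in_nbr {I} (E : nat -> 'I_I -> 'I_I -> Prop) (n : nat) (i j : 'I_I) :=
  E n j i \/ j = i.

Definition psum (a : nat -> R) (N : nat) : R := sum_f_R0 a N.

(* Main.v *)
(** The agents' disagreement in [x] and in the gradient trackers [y] obeys a coupled linear
    recursion: mixing over a long enough window contracts it (double stochasticity, joint
    connectivity and weights bounded below), and the perturbation of size [alpha n] grows at most
    linearly in the disagreements. Hence both disagreements are square summable, so
    [I y_i] approximates the gradient of [F] at the average [xbar] with an error summable
    against [alpha].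

    Optimality of the best response and strong convexity give, with [d_i = xtil_i - x_i],
      [I y_i . d_i + G (xtil_i) - G (x_i) <= - tau |d_i|^2],
    so [I F (xbar) + sum_i G (x_i)] decreases by [alpha tau sum_i |d_i|^2] up to a summable error.
    Coercivity bounds [xbar], and [sum alpha |d|^2] is finite. As the best response is a
    Lipschitz map, [d] cannot oscillate between two levels infinitely often, so [d -> 0].
    Passing to the limit in the variational inequality of the best response yields one for [F + G]
    at every limit point, and Hahn-Banach extracts from it the required subgradient of [G]. *)

Require Import Defs.
From HB Require Import structures.
From Stdlib Require Import Reals Relations Lra Classical FunctionalExtensionality ClassicalEpsilon.
From mathcomp Require Import all_boot.
Set Implicit Arguments. Unset Strict Implicit. Unset Printing Implicit Defensive.
Open Scope R_scope.

(** * Finite sums and Euclidean vectors *)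

(** Three obstacles shape the argument. The weights vary in time and contract only over a window, so
    a time-dependent seminorm is built for which every single mixing step contracts. The trackers
    are fed by the displacement of the agents, and this contains the effect of mixing, which carries
    no factor [alpha]; up to terms of order [alpha] the coupling goes one way only, from [x] to [y],
    and weighting the disagreement of [x] heavily enough restores a contraction. Finally, the
    directions have no a priori bound: the available one is affine in the disagreements to be
    estimated. Boundedness and square summability therefore come out of the same recursion on
    squares, whose perturbation [alpha ^ 2] is summable.

    [G] enters the estimates through differences of its values, which pass to the limit without any
    choice of subgradients along the iteration; the one that stationarity asks for is produced at
    the limit point. *)

Lemma Rplus_assoc_law : associative Rplus.
Proof. by move=> a b c; ring. Qed.

Lemma Rplus_comm_law : commutative Rplus.
Proof. by move=> a b; ring. Qed.

Lemma Rplus_0l_law : left_id 0 Rplus.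
Proof. by move=> a; ring. Qed.

HB.instance Definition _ :=
  Monoid.isComLaw.Build R 0 Rplus Rplus_assoc_law Rplus_comm_law Rplus_0l_law.

Lemma Rmult_0l_law : left_zero 0 Rmult.
Proof. by move=> a; ring. Qed.

Lemma Rmult_0r_law : right_zero 0 Rmult.
Proof. by move=> a; ring. Qed.

HB.instance Definition _ := Monoid.isMulLaw.Build R 0 Rmult Rmult_0l_law Rmult_0r_law.

Lemma Rmult_plusl_law : left_distributive Rmult Rplus.
Proof. by move=> a b c; ring. Qed.

Lemma Rmult_plusr_law : right_distributive Rmult Rplus.
Proof. by move=> a b c; ring. Qed.

HB.instance Definition _ :=
  Monoid.isAddLaw.Build R Rmult Rplus Rmult_plusl_law Rmult_plusr_law.

Notation "\rsum_ ( i < n ) F" := (rsumI (fun i : 'I_n => F))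
  (at level 35, F at level 35, i, n at level 50,
   format "'[' \rsum_ ( i  <  n ) '/  '  F ']'").

Section FiniteSums.
Variable n : nat.
Implicit Types F H : 'I_n -> R.

Lemma rsum_eq F H : (forall i, F i = H i) -> rsumI F = rsumI H.
Proof. by move=> FH; apply: eq_bigr => i _. Qed.

Lemma rsum_le F H : (forall i, F i <= H i) -> rsumI F <= rsumI H.
Proof.
move=> le_FH; apply: (big_ind2 (fun a b => a <= b)) => //; first lra.
by move=> a b c d; lra.
Qed.

Lemma rsum_add F H : \rsum_(i < n) (F i + H i) = rsumI F + rsumI H.
Proof. exact: big_split. Qed.

Lemma rsum_mull c F : \rsum_(i < n) (c * F i) = c * rsumI F.
Proof. by rewrite /rsumI big_distrr. Qed.

Lemma rsum_mulr c F : \rsum_(i < n) (F i * c) = rsumI F * c.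
Proof. by rewrite /rsumI big_distrl. Qed.

Lemma rsum_sub F H : \rsum_(i < n) (F i - H i) = rsumI F - rsumI H.
Proof.
rewrite (@rsum_eq _ (fun i => F i + (-1) * H i)); last by move=> i; ring.
by rewrite rsum_add rsum_mull; ring.
Qed.

Lemma rsum_const c : \rsum_(i < n) c = INR n * c.
Proof.
rewrite /rsumI big_const_ord; elim: n => [|k IHk]; first by rewrite /=; ring.
by rewrite iterS IHk S_INR; ring.
Qed.

Lemma rsum_eq0 F : (forall i, F i = 0) -> rsumI F = 0.
Proof. by move=> F0; apply: big1 => i _. Qed.

Lemma rsum_ge0 F : (forall i, 0 <= F i) -> 0 <= rsumI F.
Proof.
by move=> F_ge0; apply: (big_ind (fun a => 0 <= a)) => //; [lra | move=> a b; lra].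
Qed.

Lemma rsum_ge_term F i : (forall j, 0 <= F j) -> F i <= rsumI F.
Proof.
move=> F_ge0; rewrite /rsumI (bigD1 i) //=.
rewrite -{1}(Rplus_0_r (F i)); apply: Rplus_le_compat_l.
by apply: (big_ind (fun a => 0 <= a)) => //; [lra | move=> a b; lra].
Qed.

End FiniteSums.

Lemma rsum_exchange n p (F : 'I_n -> 'I_p -> R) :
  \rsum_(i < n) \rsum_(j < p) F i j = \rsum_(j < p) \rsum_(i < n) F i j.
Proof. exact: exchange_big. Qed.

Lemma rsum0 (F : 'I_0 -> R) : rsumI F = 0.
Proof. exact: big_ord0. Qed.

Lemma rsum_recr n (F : 'I_n.+1 -> R) :
  rsumI F = \rsum_(i < n) F (widen_ord (leqnSn n) i) + F ord_max.
Proof. exact: big_ord_recr. Qed.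

Lemma rsum_recl n (F : 'I_n.+1 -> R) :
  rsumI F = F ord0 + \rsum_(i < n) F (lift ord0 i).
Proof. exact: big_ord_recl. Qed.

Section Vectors.
Variable m : nat.
Implicit Types (u v w : vec m) (a b : R).

Lemma vdot_rsum u v : vdot u v = \rsum_(k < m) (u k * v k).
Proof. by []. Qed.

Lemma vdotC u v : vdot u v = vdot v u.
Proof. by rewrite !vdot_rsum; apply: rsum_eq => k; ring. Qed.

Lemma vdot_addl u v w : vdot (vadd u v) w = vdot u w + vdot v w.
Proof. by rewrite !vdot_rsum -rsum_add; apply: rsum_eq => k; rewrite /vadd; ring. Qed.

Lemma vdot_subl u v w : vdot (vsub u v) w = vdot u w - vdot v w.
Proof. by rewrite !vdot_rsum -rsum_sub; apply: rsum_eq => k; rewrite /vsub; ring. Qed.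

Lemma vdot_scall a u w : vdot (vscal a u) w = a * vdot u w.
Proof. by rewrite !vdot_rsum -rsum_mull; apply: rsum_eq => k; rewrite /vscal; ring. Qed.

Lemma vdot_addr u v w : vdot w (vadd u v) = vdot w u + vdot w v.
Proof. by rewrite vdotC vdot_addl !(vdotC _ w). Qed.

Lemma vdot_subr u v w : vdot w (vsub u v) = vdot w u - vdot w v.
Proof. by rewrite vdotC vdot_subl !(vdotC _ w). Qed.

Lemma vdot_scalr a u w : vdot w (vscal a u) = a * vdot w u.
Proof. by rewrite vdotC vdot_scall (vdotC _ w). Qed.

Lemma vdot_sumr n w (F : 'I_n -> vec m) : vdot w (vsumI F) = \rsum_(i < n) vdot w (F i).
Proof.
rewrite vdot_rsum -[RHS]rsum_exchange; apply: rsum_eq => k.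
by rewrite rsum_mull.
Qed.

Lemma vdot_suml n w (F : 'I_n -> vec m) : vdot (vsumI F) w = \rsum_(i < n) vdot (F i) w.
Proof. by rewrite vdotC vdot_sumr; apply: rsum_eq => i; rewrite vdotC. Qed.

Definition vdotE := (vdot_addl, vdot_subl, vdot_scall, vdot_addr, vdot_subr, vdot_scalr).

Lemma vdot_self_ge0 u : 0 <= vdot u u.
Proof. by apply: rsum_ge0 => k; nra. Qed.

Lemma vnorm_ge0 u : 0 <= vnorm u.
Proof. exact: sqrt_pos. Qed.

Lemma vnorm_sqr u : vnorm u * vnorm u = vdot u u.
Proof. exact: sqrt_sqrt (vdot_self_ge0 u). Qed.

(** With [p = vnorm u] and [q = vnorm v], the square of [q u - p v] expands to [2 p q (p q - u.v)].
    If [p q = 0], one of the vectors has only zero coordinates. *)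
Lemma cauchy_schwarz u v : vdot u v <= vnorm u * vnorm v.
Proof.
have := vnorm_sqr u; have := vnorm_sqr v.
have := vnorm_ge0 u; have := vnorm_ge0 v.
set p := vnorm u; set q := vnorm v => q0 p0 qq pp.
have h1 : 0 <= q * q * (p * p) - 2 * (p * q) * vdot u v + p * p * (q * q).
  have := vdot_self_ge0 (vsub (vscal q u) (vscal p v)).
  by rewrite !vdotE (vdotC v u) -qq -pp; lra.
have [pq0|pq_gt0] : p * q = 0 \/ 0 < p * q by nra.
  have [p_eq0|q_eq0] := Rmult_integral _ _ pq0.
    have zu k : u k = 0.
      have : u k * u k <= 0.
        have -> : 0 = vdot u u by rewrite -pp p_eq0; ring.
        by apply: (@rsum_ge_term _ (fun k => u k * u k)) => j; nra.
      by nra.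
    have -> : vdot u v = 0 by apply: rsum_eq0 => k; rewrite zu; ring.
    by nra.
  have zv k : v k = 0.
    have : v k * v k <= 0.
      have -> : 0 = vdot v v by rewrite -qq q_eq0; ring.
      by apply: (@rsum_ge_term _ (fun k => v k * v k)) => j; nra.
    by nra.
  have -> : vdot u v = 0 by apply: rsum_eq0 => k; rewrite zv; ring.
  by nra.
nra.
Qed.

Lemma vnorm_scal a u : vnorm (vscal a u) = Rabs a * vnorm u.
Proof.
rewrite /vnorm vdot_scall vdot_scalr -Rmult_assoc sqrt_mult; [|nra|exact: vdot_self_ge0].
by rewrite -/(Rsqr a) sqrt_Rsqr_abs.
Qed.

Lemma vnorm_scal_ge0 a u : 0 <= a -> vnorm (vscal a u) = a * vnorm u.
Proof. by move=> a_ge0; rewrite vnorm_scal Rabs_pos_eq. Qed.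

Lemma vnorm_opp u : vnorm (vscal (-1) u) = vnorm u.
Proof. by rewrite vnorm_scal Rabs_left; lra. Qed.

Lemma cauchy_schwarz_opp u v : - (vnorm u * vnorm v) <= vdot u v.
Proof. by have := cauchy_schwarz (vscal (-1) u) v; rewrite vdot_scall vnorm_opp; lra. Qed.

Lemma vnorm_triangle u v : vnorm (vadd u v) <= vnorm u + vnorm v.
Proof.
apply: Rsqr_incr_0_var; last by have := vnorm_ge0 u; have := vnorm_ge0 v; lra.
rewrite /Rsqr vnorm_sqr !vdotE (vdotC v u) -!vnorm_sqr.
by have := cauchy_schwarz u v; lra.
Qed.

Lemma vnorm_subC u v : vnorm (vsub u v) = vnorm (vsub v u).
Proof.
by rewrite -vnorm_opp; congr vnorm; apply: functional_extensionality => k;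
  rewrite /vscal /vsub; ring.
Qed.

Lemma vnorm_sub_triangle v u w : vnorm (vsub u w) <= vnorm (vsub u v) + vnorm (vsub v w).
Proof.
have -> : vsub u w = vadd (vsub u v) (vsub v w).
  by apply: functional_extensionality => k; rewrite /vadd /vsub; ring.
exact: vnorm_triangle.
Qed.

Lemma vnorm_sub_le u v : vnorm (vsub u v) <= vnorm u + vnorm v.
Proof.
rewrite -(vnorm_opp v); apply: Rle_trans (vnorm_triangle _ _).
by right; congr vnorm; apply: functional_extensionality => k; rewrite /vadd /vsub /vscal; ring.
Qed.

Lemma vnorm_le_add u v : vnorm u <= vnorm v + vnorm (vsub u v).
Proof.
apply: Rle_trans (vnorm_triangle _ _).
by right; congr vnorm; apply: functional_extensionality => k; rewrite /vadd /vsub; ring.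
Qed.

Lemma vnorm0 : vnorm (@vzero m) = 0.
Proof.
by rewrite /vnorm vdot_rsum rsum_eq0 ?sqrt_0 // => k; rewrite /vzero; ring.
Qed.

Lemma vnorm_subvv u : vnorm (vsub u u) = 0.
Proof.
rewrite -vnorm0; congr vnorm; apply: functional_extensionality => k.
by rewrite /vsub /vzero; ring.
Qed.

Lemma vnorm_sum n (F : 'I_n -> vec m) : vnorm (vsumI F) <= \rsum_(i < n) vnorm (F i).
Proof.
elim: n F => [|n IHn] F.
  rewrite rsum0; right; rewrite -vnorm0; congr vnorm.
  by apply: functional_extensionality => k; rewrite /vsumI big_ord0.
rewrite rsum_recl.
have -> : vsumI F = vadd (F ord0) (vsumI (fun i => F (lift ord0 i))).
  by apply: functional_extensionality => k; rewrite /vsumI big_ord_recl.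
apply: Rle_trans (vnorm_triangle _ _) _.
by apply: Rplus_le_compat_l; apply: IHn.
Qed.

End Vectors.

(** With [s] the sum of [F], the vector of entries [n F i - s] has squared norm
    [n (n sum F^2 - s^2)]; for [n > 0] the factor [n] is divided out. *)
Lemma square_sum_le n (F : 'I_n -> R) :
  (\rsum_(i < n) F i) * (\rsum_(i < n) F i) <= INR n * \rsum_(i < n) (F i * F i).
Proof.
have := vdot_self_ge0 (fun i : 'I_n => INR n * F i - \rsum_(j < n) F j).
set s := \rsum_(j < n) F j.
rewrite vdot_rsum (@rsum_eq _ _ (fun i => INR n * INR n * (F i * F i)
   + ((- 2 * INR n * s) * F i + s * s))); last by move=> i; ring.
rewrite rsum_add rsum_add !rsum_mull rsum_const -/s => h.
have [n0|n_gt0] : INR n = 0 \/ 0 < INR n by have := pos_INR n; lra.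
  have n_eq0 : n = 0%N by apply: INR_eq.
  by subst n; rewrite /s !rsum0; lra.
nra.
Qed.

Lemma vsum_eq n m (F H : 'I_n -> vec m) : (forall i, F i = H i) -> vsumI F = vsumI H.
Proof. by move=> FH; congr vsumI; apply: functional_extensionality. Qed.

Ltac vec_ring := apply: functional_extensionality => ?; rewrite /vadd /vsub /vscal; ring.

(** * Summable sequences and recursive inequalities *)

(** For nonnegative terms this is convergence of the series. The partial sums stop before [p],
    whereas [psum] includes its last index. *)
Definition bounded_sums (a : nat -> R) := exists M, forall p : nat, \rsum_(k < p) a k <= M.

Lemma rsum_S (a : nat -> R) n : \rsum_(k < n.+1) a k = \rsum_(k < n) a k + a n.
Proof. exact: rsum_recr. Qed.

Lemma rsum_Sl (a : nat -> R) n : \rsum_(k < n.+1) a k = a 0%N + \rsum_(k < n) a k.+1.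
Proof. exact: rsum_recl. Qed.

Lemma psum_rsum (a : nat -> R) N : psum a N = \rsum_(k < N.+1) a k.
Proof.
elim: N => [|N IHN]; first by rewrite rsum_S rsum0 /psum /= Rplus_0_l.
by rewrite rsum_S /= -IHN.
Qed.

Lemma rsum_cat (a : nat -> R) n p :
  \rsum_(k < n + p) a k = \rsum_(k < n) a k + \rsum_(k < p) a (n + k)%N.
Proof.
elim: p => [|p IHp]; first by rewrite addn0 rsum0; ring.
by rewrite addnS rsum_S (rsum_S (fun k => a (n + k)%N)) IHp; ring.
Qed.

Section BoundedSums.
Variable a : nat -> R.
Hypothesis a_ge0 : forall n, 0 <= a n.

Lemma Un_cv_bounded_sums l : Un_cv (psum a) l -> bounded_sums a.
Proof.
move=> cv_l; exists l => p.
have psum_le N : psum a N <= l.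
  apply: growing_ineq cv_l N => N.
  rewrite !psum_rsum (rsum_S a N.+1); have := a_ge0 N.+1; lra.
case: p => [|p]; last by rewrite -psum_rsum.
by rewrite rsum0; have := psum_le 0%N; have := a_ge0 0%N; rewrite /psum /=; lra.
Qed.

Lemma bounded_sums_tail : bounded_sums a ->
  forall e, 0 < e -> exists N, forall n p, (N <= n)%N -> \rsum_(k < p) a (n + k)%N <= e.
Proof.
case=> M le_M e e_gt0.
have [||l [l_ub l_least]] := completeness (fun r => exists p : nat, r = \rsum_(k < p) a k).
- by exists M => r [p ->].
- by exists (\rsum_(k < 0) a k), 0%N.
have [N HN] : exists N : nat, l - e < \rsum_(k < N) a k.
  apply: NNPP => noN; suff : l <= l - e by lra.
  apply: l_least => r [p ->]; apply: Rnot_lt_le => lt_r; apply: noN; by exists p.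
exists N => n p /subnKC <-.
have := rsum_cat a (N + (n - N)) p; rewrite (rsum_cat a N).
have : \rsum_(k < N + (n - N) + p) a k <= l by apply: l_ub; exists (N + (n - N) + p)%N.
have : 0 <= \rsum_(k < n - N) a (N + k)%N by apply: rsum_ge0.
lra.
Qed.

Lemma bounded_sums_cv0 : bounded_sums a -> Un_cv a 0.
Proof.
move=> /bounded_sums_tail tail e e_gt0.
have [|N HN] := tail (e / 2); first lra.
exists N => n /leP le_Nn; have := HN n 1%N le_Nn.
rewrite (rsum_S (fun k => a (n + k)%N)) rsum0 addn0 /R_dist Rminus_0_r Rabs_pos_eq //; lra.
Qed.

End BoundedSums.

Lemma bounded_sums_le a b : (forall n, a n <= b n) -> bounded_sums b -> bounded_sums a.
Proof. by move=> ab [M HM]; exists M => p; apply: Rle_trans (HM p); apply: rsum_le. Qed.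

Lemma bounded_sums_add a b :
  bounded_sums a -> bounded_sums b -> bounded_sums (fun n => a n + b n).
Proof.
move=> [M HM] [M' HM']; exists (M + M') => p; rewrite rsum_add.
by have := HM p; have := HM' p; lra.
Qed.

Lemma bounded_sums_scal c a : 0 <= c -> bounded_sums a -> bounded_sums (fun n => c * a n).
Proof.
move=> c_ge0 [M HM]; exists (c * M) => p; rewrite rsum_mull.
exact: Rmult_le_compat_l.
Qed.

Lemma Un_cv0_eventually a : Un_cv a 0 -> forall e, 0 < e ->
  exists N, forall n, (N <= n)%N -> Rabs (a n) <= e.
Proof.
move=> cv e e_gt0; have [N HN] := cv e e_gt0; exists N => n /leP le_Nn.
by have := HN n le_Nn; rewrite /R_dist Rminus_0_r; lra.
Qed.

Lemma Un_cv0_of_eventually a : (forall e, 0 < e ->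
  exists N, forall n, (N <= n)%N -> Rabs (a n) <= e) -> Un_cv a 0.
Proof.
move=> ev e e_gt0; have [|N HN] := ev (e / 2); first lra.
exists N => n /leP le_Nn; rewrite /R_dist Rminus_0_r; have := HN n le_Nn; lra.
Qed.

Lemma Un_cv0_le a b : (forall n, 0 <= a n <= b n) -> Un_cv b 0 -> Un_cv a 0.
Proof.
move=> ab cv e e_gt0; have [N HN] := cv e e_gt0; exists N => n le_Nn.
have := HN n le_Nn; rewrite /R_dist !Rminus_0_r; have [a0 le_ab] := ab n.
by rewrite !Rabs_pos_eq; lra.
Qed.

Lemma Un_cv0_sqr a : (forall n, 0 <= a n) -> Un_cv (fun n => a n * a n) 0 -> Un_cv a 0.
Proof.
move=> a_ge0 cv e e_gt0; have [|N HN] := cv (e * e); first nra.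
exists N => n le_Nn; have := HN n le_Nn; rewrite /R_dist !Rminus_0_r.
by have := a_ge0 n => an0; rewrite !Rabs_pos_eq; nra.
Qed.

Section PerturbedContraction.
Variables (rho c : R) (u a : nat -> R).
Hypotheses (rho01 : 0 <= rho < 1) (c_ge0 : 0 <= c).
Hypotheses (u_ge0 : forall n, 0 <= u n) (a_ge0 : forall n, 0 <= a n).
Hypothesis (a_sum : bounded_sums a).
Hypothesis rec : forall n, u n.+1 <= rho * u n + c * a n * (1 + u n).

(** Discrete Gronwall: bounding [rho] by 1, each step multiplies [1 + u n] by at most
    [1 + c a n <= exp (c a n)]. *)
Lemma perturbed_contraction_bounded : exists M, forall n, u n <= M.
Proof.
have [A HA] := a_sum.
have bnd n : 1 + u n <= (1 + u 0%N) * exp (c * \rsum_(k < n) a k).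
  elim: n => [|n IHn]; first by rewrite rsum0 Rmult_0_r exp_0; lra.
  rewrite rsum_S /= Rmult_plus_distr_l exp_plus.
  apply: (Rle_trans _ ((1 + u n) * (1 + c * a n))).
    have := rec n; have := u_ge0 n; nra.
  rewrite -Rmult_assoc; apply: Rmult_le_compat => //.
  - by have := u_ge0 n; lra.
  - by have := a_ge0 n; nra.
  - exact: exp_ineq1_le.
exists ((1 + u 0%N) * exp (c * A)) => n.
have := bnd n; suff : (1 + u 0%N) * exp (c * \rsum_(k < n) a k) <= (1 + u 0%N) * exp (c * A) by lra.
apply: Rmult_le_compat_l; first by have := u_ge0 0%N; lra.
have : c * \rsum_(k < n) a k <= c * A by apply: Rmult_le_compat_l.
by case=> [lt|->]; [left; apply: exp_increasing | right].
Qed.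

(** Once [u] is bounded by [M], the perturbation is at most [c (1 + M) a n]; summing the recursion,
    [rho] times the sum is absorbed on the left. *)
Lemma perturbed_contraction_summable : bounded_sums u.
Proof.
have [M HM] := perturbed_contraction_bounded; have [A HA] := a_sum.
have M_ge0 : 0 <= M by have := HM 0%N; have := u_ge0 0%N; lra.
have step p : \rsum_(k < p) u k.+1 <= rho * \rsum_(k < p) u k + c * (1 + M) * A.
  apply: (Rle_trans _ (\rsum_(k < p) (rho * u k + c * (1 + M) * a k))).
    apply: rsum_le => k; have := rec k; have := HM k.
    have : 0 <= c * a k by have := a_ge0 k; nra.
    nra.
  rewrite rsum_add !rsum_mull; have := HA p => Ap.
  have : 0 <= c * (1 + M) by nra.
  nra.
exists ((u 0%N + c * (1 + M) * A) / (1 - rho)) => p.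
apply: (Rle_trans _ (\rsum_(k < p.+1) u k)).
  by rewrite rsum_S /=; have := u_ge0 p; lra.
have pS : \rsum_(k < p.+1) u k = u 0%N + \rsum_(k < p) u k.+1.
  exact: rsum_Sl.
have le_p : \rsum_(k < p) u k <= \rsum_(k < p.+1) u k.
  by rewrite rsum_S /=; have := u_ge0 p; lra.
apply: (Rmult_le_reg_r (1 - rho)); first lra.
rewrite /Rdiv Rmult_assoc Rinv_l ?Rmult_1_r; last lra.
have := step p; nra.
Qed.

End PerturbedContraction.

(* With [k] large, [k a + b] contracts up to an [alpha]-small relative perturbation;
   its square then satisfies the recursion of [perturbed_contraction_summable],
   perturbed by [alpha ^ 2]. *)
Lemma coupled_contraction (rho c1 c2 c3 : R) (alpha a b r : nat -> R) :
  0 <= rho < 1 -> 0 <= c1 -> 0 <= c2 -> 0 <= c3 ->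
  (forall n, 0 <= alpha n <= 1) -> bounded_sums (fun n => alpha n * alpha n) ->
  (forall n, 0 <= a n) -> (forall n, 0 <= b n) -> (forall n, 0 <= r n) ->
  (forall n, r n <= c3 * (1 + a n + b n)) ->
  (forall n, a n.+1 <= rho * a n + c1 * (alpha n * r n)) ->
  (forall n, b n.+1 <= rho * b n + c2 * (a n + alpha n * r n)) ->
  (exists M, forall n, a n + b n <= M) /\
  bounded_sums (fun n => (a n + b n) * (a n + b n)).
Proof.
move=> rho01 c10 c20 c30 alpha01 alpha_sum a0 b0 r0 r_le a_rec b_rec.
(* The rate [s] is the midpoint of [rho] and 1, so that [(s - rho) k = (1 - rho) / 2 + c2] absorbs
   the feed of [a] into [b]. *)
pose k := 1 + 2 * c2 / (1 - rho); pose s := (1 + rho) / 2.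
have k_def : (k - 1) * (1 - rho) = 2 * c2 by rewrite /k; field; lra.
have k_ge1 : 1 <= k.
  suff : 0 <= c2 / (1 - rho) by rewrite /k /Rdiv; lra.
  by apply: Rmult_le_pos => //; left; apply: Rinv_0_lt_compat; lra.
pose v n := k * a n + b n; pose c4 := (k * c1 + c2) * c3.
have s01 : 0 <= s < 1 by rewrite /s; lra.
have kc : 0 <= k * c1 + c2.
  have : 0 <= k * c1 by apply: Rmult_le_pos => //; lra.
  by lra.
have c4_ge0 : 0 <= c4 by apply: Rmult_le_pos.
have v_ge n : a n + b n <= v n.
  have : 0 <= (k - 1) * a n by apply: Rmult_le_pos => //; lra.
  by rewrite /v; lra.
have v0 n : 0 <= v n by have := v_ge n; have := a0 n; have := b0 n; lra.
have v_rec n : v n.+1 <= s * v n + c4 * (alpha n * (1 + v n)).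
  have ar : alpha n * r n <= alpha n * (c3 * (1 + v n)).
    apply: Rmult_le_compat_l; first by have := alpha01 n; lra.
    by apply: Rle_trans (r_le n) _; apply: Rmult_le_compat_l => //; have := v_ge n; lra.
  have := a_rec n; have := b_rec n.
  have := Rmult_le_compat_l _ _ _ kc ar.
  have ka : k * rho * a n + c2 * a n <= s * (k * a n).
    suff : 0 <= a n * (s * k - k * rho - c2) by lra.
    by apply: Rmult_le_pos => //; move: k_def; rewrite /s; lra.
  have : rho * b n <= s * b n by apply: Rmult_le_compat_r => //; rewrite /s; lra.
  rewrite /v /c4 => h1 h2 h3 h4.
  have h5 : k * a n.+1 <= k * (rho * a n + c1 * (alpha n * r n)) by apply: Rmult_le_compat_l; lra.
  move: h1 h2 h3 h4 h5; rewrite /v; clearbody s k; clear -ka; lra.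
(* The 2 comes from [(1 + v)^2 <= 2 (1 + v^2)], the denominator from writing the perturbation as
   [(1 - s) q]. *)
pose u n := v n * v n; pose c := 2 * (c4 * c4) / (1 - s).
have c_def : c * (1 - s) = 2 * (c4 * c4) by rewrite /c; field; lra.
have c_ge0 : 0 <= c.
  by apply: Rmult_le_pos; [nra | left; apply: Rinv_0_lt_compat; lra].
have u0 n : 0 <= u n by rewrite /u; nra.
have u_rec n : u n.+1 <= s * u n + c * (alpha n * alpha n) * (1 + u n).
  (* convexity of the square: [(s v + (1-s) q)^2 <= s v^2 + (1-s) q^2] *)
  pose q := c4 * (alpha n * (1 + v n)) / (1 - s).
  have q_def : q * (1 - s) = c4 * (alpha n * (1 + v n)) by rewrite /q; field; lra.
  have sq : u n.+1 <= (s * v n + (1 - s) * q) * (s * v n + (1 - s) * q).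
    have := v_rec n; have := v0 n.+1; rewrite /u => h1 h2.
    by apply: Rmult_le_compat; lra.
  have cvx : (s * v n + (1 - s) * q) * (s * v n + (1 - s) * q) <= s * u n + (1 - s) * (q * q).
    suff : 0 <= s * (1 - s) * ((v n - q) * (v n - q)) by rewrite /u; lra.
    by apply: Rmult_le_pos; [nra | exact: Rle_0_sqr].
  have qq : (1 - s) * (q * q) <= c * (alpha n * alpha n) * (1 + u n).
    apply: (Rmult_le_reg_r (1 - s)); first lra.
    have -> : (1 - s) * (q * q) * (1 - s) = (q * (1 - s)) * (q * (1 - s)) by ring.
    have -> : c * (alpha n * alpha n) * (1 + u n) * (1 - s)
            = c * (1 - s) * ((alpha n * alpha n) * (1 + u n)) by ring.
    rewrite q_def c_def.
    suff : 0 <= (c4 * c4) * (alpha n * alpha n) * ((1 - v n) * (1 - v n)) by rewrite /u; lra.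
    by apply: Rmult_le_pos; [nra | exact: Rle_0_sqr].
  lra.
have alpha2_ge0 n : 0 <= alpha n * alpha n by have := alpha01 n; nra.
split.
  have [M HM] := perturbed_contraction_bounded s01 c_ge0 u0 alpha2_ge0 alpha_sum u_rec.
  exists (1 + M) => n; have := HM n; have := v_ge n; have := v0 n; rewrite /u; nra.
have := perturbed_contraction_summable s01 c_ge0 u0 alpha2_ge0 alpha_sum u_rec.
apply: bounded_sums_le => n; have := v_ge n; have := a0 n; have := b0 n.
by rewrite /u => h1 h2 h3; apply: Rmult_le_compat; lra.
Qed.

Lemma descent_telescope (psi w e : nat -> R) :
  (forall n, psi n.+1 <= psi n - w n + e n) ->
  forall n, psi n + \rsum_(k < n) w k <= psi 0%N + \rsum_(k < n) e k.
Proof.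
move=> rec; elim=> [|n IHn]; first by rewrite !rsum0; lra.
by rewrite !rsum_S /=; have := rec n; lra.
Qed.

(** * Sequences of small variation along the path that are square summable against the step sizes *)

Section Crossing.
(** [V] will be the disagreement, which enters the variation of [delta] only at the two end times,
    and [e] the total tolerance, which adds to the path length. *)
Variables (C : R) (alpha delta V e : nat -> R).
Hypotheses (C_ge0 : 0 <= C) (alpha_ge0 : forall n, 0 <= alpha n).
Hypotheses (delta_ge0 : forall n, 0 <= delta n) (V_ge0 : forall n, 0 <= V n).
Hypothesis e_ge0 : forall n, 0 <= e n.
Hypotheses (V_cv : Un_cv V 0) (alpha_cv : Un_cv alpha 0).
Hypothesis alpha_unbounded : ~ bounded_sums alpha.
Hypothesis delta_sum : bounded_sums (fun n => alpha n * (delta n * delta n)).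
Hypothesis e_sum : bounded_sums (fun n => alpha n * e n).
Hypothesis delta_lip : forall n p, delta (n + p)%N <= delta n +
  C * (V n + V (n + p)%N + \rsum_(k < p) (alpha (n + k)%N * (delta (n + k)%N + e (n + k)%N))).

(** Otherwise [alpha eta^2 <= alpha delta^2] from [N] on, and [alpha] would be summable. *)
Lemma frequently_small eta N : 0 < eta -> exists n, (N <= n)%N /\ delta n <= eta.
Proof.
move=> eta_gt0; apply: NNPP => none; apply: alpha_unbounded.
have [M HM] := delta_sum.
have big_delta n : (N <= n)%N -> eta <= delta n.
  move=> le_Nn; apply: Rnot_lt_le => lt; apply: none; exists n; split=> //; lra.
exists (\rsum_(k < N) alpha k + M / (eta * eta)) => p.
have eta2 : 0 < eta * eta by nra.
apply: (Rle_trans _ (\rsum_(k < N + p) alpha k)).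
  rewrite addnC rsum_cat; have : 0 <= \rsum_(k < N) alpha (p + k)%N by apply: rsum_ge0.
  lra.
rewrite rsum_cat; apply: Rplus_le_compat_l.
apply: (Rmult_le_reg_r (eta * eta)) => //.
rewrite /Rdiv Rmult_assoc Rinv_l ?Rmult_1_r; last lra.
apply: Rle_trans (HM (N + p)%N).
rewrite (rsum_cat (fun k => alpha k * (delta k * delta k))) -rsum_mulr.
have : 0 <= \rsum_(k < N) (alpha k * (delta k * delta k)).
  by apply: rsum_ge0 => k; apply: Rmult_le_pos => //; nra.
suff : \rsum_(k < p) (alpha (N + k)%N * (eta * eta)) <=
  \rsum_(k < p) (alpha (N + k)%N * (delta (N + k)%N * delta (N + k)%N)) by lra.
apply: rsum_le => k; apply: Rmult_le_compat_l => //.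
have := big_delta (N + k)%N (leq_addr _ _); nra.
Qed.

(* Between a time where [delta <= eta/2] and a later one where [delta > eta], the path length
   [sum alpha delta] is controlled by [(2/eta) sum alpha delta^2], which is a small tail. *)
Lemma crossing_cv0 : Un_cv delta 0.
Proof.
apply: Un_cv0_of_eventually => eta eta_gt0.
(* Five errors of size [eta / c] will occur: one for each [V], one for the tolerances, two for the
   path. Times [C] they total at most [5 eta / 16], which is below [eta / 2]. *)
pose c := 16 * (C + 1).
have c_gt0 : 0 < c by rewrite /c; lra.
have Cc : C * / c <= / 16.
  apply: (Rmult_le_reg_r c) => //; rewrite Rmult_assoc Rinv_l; last lra.
  by rewrite /c; lra.
have ic : 0 < / c by apply: Rinv_0_lt_compat.
have [N1 HN1] := Un_cv0_eventually V_cv (Rmult_lt_0_compat _ _ eta_gt0 ic).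
have [N2 HN2] := Un_cv0_eventually alpha_cv ic.
have ad_ge0 n : 0 <= alpha n * (delta n * delta n) by apply: Rmult_le_pos => //; nra.
have ae_ge0 n : 0 <= alpha n * e n by apply: Rmult_le_pos.
(* Multiplied by the factor [2 / eta] of the path estimate, this tail becomes [eta / c]. *)
have [|N3 HN3] := bounded_sums_tail ad_ge0 delta_sum (e := eta * eta * / c * / 2).
  by apply: Rmult_lt_0_compat; [apply: Rmult_lt_0_compat => //; nra | lra].
have [|N4 HN4] := bounded_sums_tail ae_ge0 e_sum (e := eta * / c).
  exact: Rmult_lt_0_compat.
have [p0 [p0_ge p0_small]] := @frequently_small (eta / 2) (N1 + N2 + N3 + N4) ltac:(lra).
exists p0 => n /subnKC <-; rewrite Rabs_pos_eq //; move: (n - p0)%N => k {n}.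
(* [p] is the last time up to [p0 + k] with [delta <= eta / 2]; it exists because [p0] is such a
   time. *)
have [p [q [p_ge pq p_small q_big]]] : exists p q,
    [/\ (N1 + N2 + N3 + N4 <= p)%N, (p + q = p0 + k)%N, delta p <= eta / 2
      & forall j, (0 < j)%N -> (j <= q)%N -> eta / 2 < delta (p + j)%N].
  elim: k => [|k [p [q [p_ge pq p_small q_big]]]].
    by exists p0, 0%N; split => // j; rewrite leqn0 lt0n => /negbTE ->.
  have [small|big] := Rle_lt_dec (delta (p0 + k.+1)%N) (eta / 2).
    exists (p0 + k.+1)%N, 0%N; split => //; first exact: leq_trans (leq_addr _ _).
      by rewrite addn0.
    by move=> j; rewrite leqn0 lt0n => /negbTE ->.
  exists p, q.+1; split => //; first by rewrite addnS pq addnS.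
  move=> j j_gt0; rewrite leq_eqVlt => /orP[/eqP ->|]; last exact: q_big.
  by rewrite addnS pq -addnS.
rewrite -pq; have lt_eta : 0 < eta / 2 by lra.
have le1 : (N1 <= p)%N by apply: leq_trans p_ge; rewrite -!addnA leq_addr.
have le2 : (N2 <= p)%N by apply: leq_trans p_ge; rewrite (addnC N1) -!addnA leq_addr.
have le3 : (N3 <= p)%N by apply: leq_trans p_ge; rewrite (addnC (_ + _)%N N3) -!addnA leq_addr.
have le4 : (N4 <= p)%N by apply: leq_trans p_ge; rewrite leq_addl.
have ieta : eta * / eta = 1 by field; lra.
have ieta0 : 0 < / eta by apply: Rinv_0_lt_compat.
(* The lower bound [eta / 2 < delta] fails at [p] itself, so the first term is kept apart; it is
   small because [alpha] tends to 0. *)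
have path : \rsum_(j < q) (alpha (p + j)%N * delta (p + j)%N) <=
   alpha p * (eta / 2) + 2 * / eta *
      \rsum_(j < q) (alpha (p + j)%N * (delta (p + j)%N * delta (p + j)%N)).
  case: q q_big {pq} => [|q] q_big.
    by rewrite !rsum0; have := alpha_ge0 p; nra.
  rewrite (rsum_Sl (fun j => alpha (p + j)%N * delta (p + j)%N)).
  rewrite (rsum_Sl (fun j => alpha (p + j)%N * (delta (p + j)%N * delta (p + j)%N))) addn0.
  have : \rsum_(j < q) (alpha (p + j.+1)%N * delta (p + j.+1)%N) <=
     2 * / eta * \rsum_(j < q) (alpha (p + j.+1)%N * (delta (p + j.+1)%N * delta (p + j.+1)%N)).
    rewrite -rsum_mull; apply: rsum_le => j.
    have := q_big j.+1 isT (ltnW (ltn_ord j)); set d := delta _ => d_big.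
    have -> : 2 * / eta * (alpha (p + j.+1)%N * (d * d)) =
              alpha (p + j.+1)%N * (d * (2 * / eta * d)) by ring.
    apply: Rmult_le_compat_l => //; rewrite -{1}(Rmult_1_r d); apply: Rmult_le_compat_l; first lra.
    have : / eta * (eta / 2) <= / eta * d by apply: Rmult_le_compat_l; lra.
    have : / eta * (eta / 2) = / 2 by field; lra.
    by lra.
  have : alpha p * delta p <= alpha p * (eta / 2) by apply: Rmult_le_compat_l.
  have : 0 <= 2 * / eta * (alpha p * (delta p * delta p)).
    by apply: Rmult_le_pos; [lra | exact: ad_ge0].
  lra.
have := delta_lip p q.
rewrite (@rsum_eq _ _ (fun k : 'I_q => alpha (p + k)%N * delta (p + k)%N
  + alpha (p + k)%N * e (p + k)%N));
  last by move=> j; ring.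
rewrite rsum_add.
have := HN1 p le1; rewrite Rabs_pos_eq // => Vp.
have := HN1 (p + q)%N (leq_trans le1 (leq_addr _ _)); rewrite Rabs_pos_eq // => Vpq.
have := HN2 p le2; rewrite Rabs_pos_eq // => ap.
have := HN3 p q le3 => tail3; have := HN4 p q le4 => tail4 lip.
have path2 : \rsum_(j < q) (alpha (p + j)%N * delta (p + j)%N) <= 2 * (eta * / c).
  have h : 2 * / eta * \rsum_(j < q) (alpha (p + j)%N * (delta (p + j)%N * delta (p + j)%N))
      <= 2 * / eta * (eta * eta * / c * / 2) by apply: Rmult_le_compat_l => //; lra.
  have h2 : 2 * / eta * (eta * eta * / c * / 2) = eta * / c by field; lra.
  have : alpha p * (eta / 2) <= / c * (eta / 2) by apply: Rmult_le_compat_r; lra.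
  nra.
move: lip; set S1 := \rsum_(_ < _) _; set S2 := \rsum_(_ < _) _ => lip.
have tot : C * (V p + V (p + q)%N + (S1 + S2)) <= C * (5 * (eta * / c)).
  by apply: Rmult_le_compat_l => //; rewrite /S1 /S2; lra.
have : C * (5 * (eta * / c)) <= 5 * eta / 16.
  have -> : C * (5 * (eta * / c)) = 5 * eta * (C * / c) by ring.
  by nra.
lra.
Qed.

End Crossing.

(** * Convex analysis *)

Section ConeSeparation.
(** [E v r] plays the part of [p v <= r] for a sublinear [p]; separation then yields a linear form
    below [p]. *)
Variables (m : nat) (E : vec m -> R -> Prop).
Hypothesis E_add : forall v r v' r', E v r -> E v' r' -> E (vadd v v') (r + r').
Hypothesis E_scal : forall s v r, 0 < s -> E v r -> E (vscal s v) (s * r).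
Hypothesis E0 : forall r, E vzero r -> 0 <= r.
Hypothesis E_total : forall v, exists r, E v r.

(* Finite-dimensional Hahn-Banach: the functional is extended one coordinate at a time, the
   new coefficient being a supremum that the convexity of [E] keeps below the upper constraints. *)
Lemma cone_separation : exists xi, forall v r, E v r -> vdot xi v <= r.
Proof.
suff gen k : (k <= m)%N -> exists xi, forall v r, (forall j : 'I_m, (k <= j)%N -> v j = 0) ->
    E v r -> vdot xi v <= r.
  have [xi xiP] := gen m (leqnn m); exists xi => v r Evr; apply: xiP => // j.
  by rewrite leqNgt ltn_ord.
elim: k => [|k IHk] lekm.
  exists vzero => v r v0 Evr.
  have v_eq0 : v = vzero by apply: functional_extensionality => j; rewrite v0.
  rewrite v_eq0 in Evr *; rewrite vdot_rsum rsum_eq0; first exact: E0.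
  by move=> j; rewrite /vzero; ring.
have [xi xiP] := IHk (ltnW lekm).
pose kk := Ordinal lekm.
pose e : vec m := fun j => if j == kk then 1 else 0.
have e_kk : e kk = 1 by rewrite /e eqxx.
have dot_e v : vdot e v = v kk.
  rewrite vdot_rsum /rsumI (bigD1 kk) //= e_kk Rmult_1_l big1 ?Rplus_0_r //.
  by move=> j /negbTE jk; rewrite /e jk; ring.
pose flat v := forall j : 'I_m, (k.+1 <= j)%N -> v j = 0.
have flatP v : flat v -> v kk = 0 -> forall j : 'I_m, (k <= j)%N -> v j = 0.
  move=> fv vk j; rewrite leq_eqVlt => /orP[/eqP kj|]; last exact: fv.
  by have -> : j = kk by apply: val_inj.
(* Lower constraints on the new coefficient come from vectors with entry -1 at [kk], upper ones from
   entry 1. The sum of two such vectors falls in the smaller subspace, where [xi] already works. *)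
have cross v r v' r' : flat v -> v kk = -1 -> E v r -> flat v' -> v' kk = 1 -> E v' r' ->
    vdot xi v - r <= r' - vdot xi v'.
  move=> fv vk Ev fv' vk' Ev'.
  have := xiP _ _ _ (E_add Ev Ev'); rewrite vdot_addr => h.
  suff : vdot xi v + vdot xi v' <= r + r' by lra.
  apply: h; apply: flatP => [j kj|]; last by rewrite /vadd vk vk'; ring.
  by rewrite /vadd fv // fv' //; ring.
have e_flat : flat e.
  move=> j kj; rewrite /e; case: eqP => // jk.
  by move: kj; rewrite jk /= ltnn.
(* One constraint from above and one from below, so that the supremum exists. *)
have [r1 E1] := E_total e; have [r2 E2] := E_total (vscal (-1) e).
have ne_flat : flat (vscal (-1) e) by move=> j kj; rewrite /vscal e_flat //; ring.
have ne_kk : vscal (-1) e kk = -1 by rewrite /vscal e_kk; ring.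
have [||a [a_ub a_least]] := completeness (fun q => exists v r,
   [/\ flat v, v kk = -1, E v r & q = vdot xi v - r]).
- by exists (r1 - vdot xi e) => q [v [r [fv vk Ev ->]]]; apply: cross.
- by exists (vdot xi (vscal (-1) e) - r2), (vscal (-1) e), r2.
exists (vadd xi (vscal a e)) => v r fv Ev.
rewrite vdot_addl vdot_scall dot_e.
have scal_flat s : flat (vscal s v) by move=> j kj; rewrite /vscal fv //; ring.
have [neg|[zero|pos]] := Rtotal_order (v kk) 0.
- have s_gt0 : 0 < / (- v kk) by apply: Rinv_0_lt_compat; lra.
  have sv : / (- v kk) * v kk = -1 by field; lra.
  have : vdot xi (vscal (/ (- v kk)) v) - / (- v kk) * r <= a.
    apply: a_ub; exists (vscal (/ (- v kk)) v), (/ (- v kk) * r).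
    by split => //; apply: E_scal.
  rewrite vdot_scalr => h.
  have := Rmult_le_compat_l (- v kk) _ _ ltac:(lra) h.
  have -> : - v kk * (/ - v kk * vdot xi v - / - v kk * r) = vdot xi v - r by field; lra.
  by lra.
- rewrite zero Rmult_0_r Rplus_0_r; apply: xiP => //; exact: flatP.
- have s_gt0 : 0 < / v kk by apply: Rinv_0_lt_compat; lra.
  have sv : / v kk * v kk = 1 by field; lra.
  have h : a <= / v kk * r - vdot xi (vscal (/ v kk) v).
    apply: a_least => q [v' [r' [fv' vk' Ev' ->]]].
    by apply: cross => //; apply: E_scal.
  rewrite vdot_scalr in h.
  have := Rmult_le_compat_l (v kk) _ _ ltac:(lra) h.
  have -> : v kk * (/ v kk * r - / v kk * vdot xi v) = r - vdot xi v by field; lra.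
  by lra.
Qed.

End ConeSeparation.

Section ConvexFunctions.
Variable m : nat.
Implicit Types (K : vec m -> Prop) (G f : vec m -> R) (u v w x g xi : vec m).

(* Separation for the cone generated by the pairs [(y - w, G y - G x + g.(w - x))], [w] in [K]:
   [w = x] then yields the subgradient inequality and [y = x] the one over [K]. *)
Lemma subgrad_sum_rule K G x g : vconvex_fun G -> vconvex_set K -> K x ->
  (forall w, K w -> 0 <= vdot g (vsub w x) + (G w - G x)) ->
  exists xi, subgrad G x xi /\ forall w, K w -> 0 <= vdot (vadd g xi) (vsub w x).
Proof.
move=> cvxG cvxK Kx opt.
pose E v r := exists s y w, [/\ 0 < s, K w, v = vscal s (vsub y w)
  & s * (G y - G x + vdot g (vsub w x)) <= r].
have [||||xi xiP] := @cone_separation m E.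
- move=> v r v' r' [s [y [w [s0 Kw -> le_r]]]] [s' [y' [w' [s'0 Kw' -> le_r']]]].
  (* Two generators with factors [s] and [s'] add up to one with factor [s + s'], taken at the
     convex combinations of weight [t]; convexity of [G] and [K] makes it admissible. *)
  pose t := s / (s + s').
  have st : (s + s') * t = s by rewrite /t; field; lra.
  have st' : (s + s') * (1 - t) = s' by rewrite /t; field; lra.
  have t01 : 0 <= t <= 1 by split; nra.
  exists (s + s'), (vadd (vscal t y) (vscal (1 - t) y')), (vadd (vscal t w) (vscal (1 - t) w')).
  split; first lra.
  + exact: cvxK.
  + apply: functional_extensionality => k; rewrite /vadd /vsub /vscal.
    transitivity ((s + s') * t * (y k - w k) + (s + s') * (1 - t) * (y' k - w' k)).
      by rewrite st st'.
    by ring.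
  have cvx : (s + s') * G (vadd (vscal t y) (vscal (1 - t) y')) <=
      (s + s') * t * G y + (s + s') * (1 - t) * G y'.
    by have := Rmult_le_compat_l (s + s') _ _ ltac:(lra) (cvxG y y' t t01); lra.
  rewrite !vdotE in le_r le_r' *.
  have dotE : (s + s') * (t * vdot g w + (1 - t) * vdot g w') =
      (s + s') * t * vdot g w + (s + s') * (1 - t) * vdot g w' by ring.
  by rewrite st st' in cvx dotE; lra.
- move=> s v r s0 [s1 [y [w [s10 Kw -> le_r]]]].
  exists (s * s1), y, w; split => //; first nra.
    by vec_ring.
  by rewrite Rmult_assoc; apply: Rmult_le_compat_l; lra.
- move=> r [s [y [w [s0 Kw zero le_r]]]].
  have yw : y = w.
    apply: functional_extensionality => k.
    have := congr1 (fun h => h k) zero; rewrite /vzero /vscal /vsub => h.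
    have [|] := Rmult_integral s (y k - w k) ltac:(lra); lra.
  have := opt w Kw; rewrite -yw in le_r * => h; nra.
- move=> v; exists (1 * (G (vadd x v) - G x + vdot g (vsub x x))), 1, (vadd x v), x.
  split => //; [lra | by vec_ring | by right].
have main y w : K w -> vdot xi (vsub y w) <= G y - G x + vdot g (vsub w x).
  move=> Kw; apply: xiP; exists 1, y, w; split => //; [lra | by vec_ring | by right; ring].
exists xi; split.
  by move=> y; have := main y x Kx; rewrite !vdotE; lra.
by move=> w Kw; have := main x w Kw; rewrite !vdotE; lra.
Qed.

(** The sum rule for the one-point set [{x}] and the zero gradient. *)
Lemma subgrad_exists G x : vconvex_fun G -> exists xi, subgrad G x xi.
Proof.
move=> cvxG.
have [||w ->|xi [sub _]] := @subgrad_sum_rule (fun w => w = x) G x vzero cvxG.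
- by move=> u v t -> -> _; vec_ring.
- by [].
- by rewrite !vdotE; lra.
- by exists xi.
Qed.

(** Only a subgradient at [u] enters, hence the one-sided form with [v] arbitrary. *)
Lemma convex_lipschitz G K LG : vconvex_fun G ->
  (forall u xi, K u -> subgrad G u xi -> vnorm xi <= LG) ->
  forall u v, K u -> G u - G v <= LG * vnorm (vsub u v).
Proof.
move=> cvxG bnd u v Ku; have [xi xiP] := subgrad_exists u cvxG.
have := xiP v; have := bnd u xi Ku xiP.
have := cauchy_schwarz xi (vsub u v); have := vnorm_ge0 (vsub u v).
rewrite !vdotE; nra.
Qed.

(** Averaging the affine minorant of [G] that touches it at the barycentre [p] returns exactly
    [G p]. *)
Lemma convex_jensen G n (c : 'I_n -> R) (z : 'I_n -> vec m) : vconvex_fun G ->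
  (forall j, 0 <= c j) -> rsumI c = 1 ->
  G (vsumI (fun j => vscal (c j) (z j))) <= \rsum_(j < n) (c j * G (z j)).
Proof.
move=> cvxG c0 c1; set p := vsumI _.
have [xi xiP] := subgrad_exists p cvxG.
have dot_p : \rsum_(j < n) (c j * vdot xi (z j)) = vdot xi p.
  by rewrite vdot_sumr; apply: rsum_eq => j; rewrite vdot_scalr.
have -> : G p = \rsum_(j < n) (c j * (G p + vdot xi (vsub (z j) p))).
  rewrite (@rsum_eq _ _ (fun j => c j * (G p - vdot xi p) + c j * vdot xi (z j))); last first.
    by move=> j; rewrite vdot_subr; ring.
  by rewrite rsum_add rsum_mulr c1 dot_p; ring.
by apply: rsum_le => j; apply: Rmult_le_compat_l.
Qed.

Lemma convex_set_comb K n (c : 'I_n -> R) (z : 'I_n -> vec m) : vconvex_set K ->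
  (forall j, 0 <= c j) -> rsumI c = 1 -> (forall j, K (z j)) ->
  K (vsumI (fun j => vscal (c j) (z j))).
Proof.
move=> cvxK.
(* Removing a point breaks the normalization, so the induction runs over weights of any positive
   total. *)
suff gen : (forall j, 0 <= c j) -> 0 < rsumI c -> (forall j, K (z j)) ->
    K (vscal (/ rsumI c) (vsumI (fun j => vscal (c j) (z j)))).
  move=> c0 c1 Kz; have := gen c0; rewrite c1 => h.
  have -> : vsumI (fun j => vscal (c j) (z j)) = vscal (/ 1) (vsumI (fun j => vscal (c j) (z j))).
    by apply: functional_extensionality => k; rewrite /vscal; field.
  by apply: h => //; lra.
elim: n c z => [|n IHn] c z c0 c_gt0 Kz; first by rewrite rsum0 in c_gt0; lra.
pose c' i := c (lift ord0 i); pose z' i := z (lift ord0 i).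
have cE : rsumI c = c ord0 + rsumI c' by rewrite rsum_recl.
have zE : vsumI (fun j => vscal (c j) (z j)) =
    vadd (vscal (c ord0) (z ord0)) (vsumI (fun j => vscal (c' j) (z' j))).
  by apply: functional_extensionality => k; rewrite /vsumI big_ord_recl.
have [c'0|c'_gt0] : rsumI c' = 0 \/ 0 < rsumI c'.
  have : 0 <= rsumI c' by apply: rsum_ge0 => i; apply: c0.
  by lra.
  have c'_eq0 i : c' i = 0.
    have h : 0 <= c' i by apply: c0.
    have : c' i <= rsumI c' by apply: rsum_ge_term => j; apply: c0.
    by lra.
  rewrite zE cE c'0 Rplus_0_r; rewrite cE c'0 in c_gt0.
  have -> : vscal (/ c ord0) (vadd (vscal (c ord0) (z ord0)) (vsumI (fun j => vscal (c' j) (z' j))))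
     = z ord0; last exact: Kz.
  apply: functional_extensionality => k; rewrite /vscal /vadd.
  have -> : vsumI (fun j : 'I_n => fun k => c' j * z' j k) k = 0.
    by apply: rsum_eq0 => i; rewrite c'_eq0; ring.
  by field; lra.
have := IHn c' z' (fun i => c0 _) c'_gt0 (fun i => Kz _).
set V := vsumI _ => Kq.
have s0 : 0 < c ord0 + rsumI c' by rewrite -cE.
pose t := c ord0 / (c ord0 + rsumI c').
have t01 : 0 <= t <= 1.
  have : t * (c ord0 + rsumI c') = c ord0 by rewrite /t; field; lra.
  have := c0 ord0; nra.
have -> : vscal (/ rsumI c) (vsumI (fun j => vscal (c j) (z j))) =
   vadd (vscal t (z ord0)) (vscal (1 - t) (vscal (/ rsumI c') V)).
  rewrite zE cE -/V; apply: functional_extensionality => k.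
  rewrite /t /vscal /vadd.
  by move: (V k) (rsumI c') c'_gt0 s0 => Vk s s_gt0 s0; field; lra.
exact: cvxK.
Qed.

Lemma vadd_segment t v w : vadd (vscal t w) (vscal (1 - t) v) = vadd v (vscal t (vsub w v)).
Proof. by vec_ring. Qed.

(** A relative gradient speaks only of points of [K]; by convexity the segment towards [w] consists
    of such points. *)
Lemma grad_rel_directional K f g v w : vconvex_set K -> K v -> K w -> has_grad_rel K f g v ->
  forall e, 0 < e -> exists t0, 0 < t0 <= 1 /\ forall t, 0 < t <= t0 ->
    Rabs (f (vadd (vscal t w) (vscal (1 - t) v)) - f v - t * vdot g (vsub w v)) <= e * t.
Proof.
move=> cvxK Kv Kw grad e e_gt0.
(* The [+ 1] keeps [D] invertible when [w = v]. *)
pose D := vnorm (vsub w v) + 1.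
have D_ge1 : 1 <= D by have := vnorm_ge0 (vsub w v); rewrite /D; lra.
have iD : D * / D = 1 by field; lra.
have iD0 : 0 < / D by apply: Rinv_0_lt_compat; lra.
have [d [d_gt0 dP]] := grad (e * / D) (Rmult_lt_0_compat _ _ e_gt0 iD0).
exists (Rmin 1 (d * / D)); split.
  split; last exact: Rmin_l.
  by apply: Rmin_glb_lt; [lra | apply: Rmult_lt_0_compat].
move=> t [t_gt0 t_le].
have t_le1 := Rle_trans _ _ _ t_le (Rmin_l _ _).
have t_led := Rle_trans _ _ _ t_le (Rmin_r _ _).
have := dP (vadd (vscal t w) (vscal (1 - t) v)).
have -> : vsub (vadd (vscal t w) (vscal (1 - t) v)) v = vscal t (vsub w v) by vec_ring.
rewrite vdot_scalr vnorm_scal_ge0; last lra.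
have nD : vnorm (vsub w v) < D by rewrite /D; lra.
have n0 := vnorm_ge0 (vsub w v).
move=> h; apply: Rle_trans (h _ _) _.
- by apply: cvxK => //; lra.
- have : t * D <= d / D * D by apply: Rmult_le_compat_r; lra.
  have -> : d / D * D = d by field; lra.
  nra.
- have : / D * vnorm (vsub w v) <= 1 by rewrite -iD Rmult_comm; apply: Rmult_le_compat_r; lra.
  have et : 0 < e * t by nra.
  move=> h1; have := Rmult_le_compat_l (e * t) _ _ ltac:(lra) h1; lra.
Qed.

Lemma le_of_eps a b : (forall e, 0 < e -> a <= b + e) -> a <= b.
Proof.
by move=> h; apply: Rnot_lt_le => lt_ba; have := h ((a - b) / 2) ltac:(lra); lra.
Qed.

(** Strong convexity between [v] and the point at parameter [t], divided by [t]. Half of [e] pays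
    for the directional derivative, the other half for the leftover [t tau n2 / 2]. *)
Lemma strongly_convex_first_order K tau f g v w : vconvex_set K -> 0 < tau ->
  strongly_convex_on K tau f -> has_grad_rel K f g v -> K v -> K w ->
  f v + vdot g (vsub w v) + tau / 2 * vnorm (vsub w v) ^ 2 <= f w.
Proof.
move=> cvxK tau_gt0 sc grad Kv Kw; set n2 := vnorm _ ^ 2.
have n2_ge0 : 0 <= n2 by rewrite /n2; have := vnorm_ge0 (vsub w v); nra.
apply: le_of_eps => e e_gt0.
have [t0 [t0P dirP]] := grad_rel_directional cvxK Kv Kw grad (e := e / 2) ltac:(lra).
have q0 : 0 < tau * n2 + 1 by nra.
pose t := Rmin t0 (e / (tau * n2 + 1)).
have eq0 : 0 < e / (tau * n2 + 1) by apply: Rdiv_lt_0_compat.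
have t_gt0 : 0 < t by apply: Rmin_glb_lt; lra.
have t_le : t <= t0 by apply: Rmin_l.
have t_e : t * (tau * n2 + 1) <= e.
  have : t * (tau * n2 + 1) <= e / (tau * n2 + 1) * (tau * n2 + 1).
    by apply: Rmult_le_compat_r; [lra | apply: Rmin_r].
  by have -> : e / (tau * n2 + 1) * (tau * n2 + 1) = e by field; lra.
have := dirP t ltac:(lra); have := sc w v t Kw Kv ltac:(lra).
rewrite -/n2; set ft := f (vadd _ _) => h1 h2.
have {}h2 : - (e / 2 * t) <= ft - f v - t * vdot g (vsub w v).
  by have := Rle_abs (- (ft - f v - t * vdot g (vsub w v))); rewrite Rabs_Ropp; lra.
apply: (Rmult_le_reg_l t) => //.
have : t * (t * (tau * n2 + 1)) <= t * e by apply: Rmult_le_compat_l; lra.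
have := t_gt0; nra.
Qed.

Lemma strongly_monotone_grad K tau f gv gw v w : vconvex_set K -> 0 < tau ->
  strongly_convex_on K tau f -> has_grad_rel K f gv v -> has_grad_rel K f gw w ->
  K v -> K w -> tau * vnorm (vsub w v) ^ 2 <= vdot (vsub gw gv) (vsub w v).
Proof.
move=> cvxK tau0 sc Hv Hw Kv Kw.
have := strongly_convex_first_order cvxK tau0 sc Hv Kv Kw.
have := strongly_convex_first_order cvxK tau0 sc Hw Kw Kv.
rewrite (vnorm_subC v w) !vdotE; lra.
Qed.

(** Comparing [a] with a point slightly towards [w], [f] is linearised while [G] is bounded by
    convexity, so [G] stays in the form of a difference of values. *)
Lemma argmin_variational K G f g p c a : vconvex_set K -> vconvex_fun G -> K a ->
  has_grad_rel K f g a ->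
  (forall w, K w -> f a + vdot p (vsub a c) + G a <= f w + vdot p (vsub w c) + G w) ->
  forall w, K w -> 0 <= vdot (vadd g p) (vsub w a) + (G w - G a).
Proof.
move=> cvxK cvxG Ka grad amin w Kw.
apply: le_of_eps => e e_gt0.
have [t [tP dirP]] := grad_rel_directional cvxK Ka Kw grad e_gt0.
have := dirP t ltac:(lra); have := amin _ (cvxK w a t Kw Ka ltac:(lra)).
have := cvxG w a t ltac:(lra).
set q := vadd _ _; set ft := f q; set Gt := G q => h1 h2 h3.
have {}h3 : ft - f a - t * vdot g (vsub w a) <= e * t.
  by apply: Rle_trans h3; apply: Rle_abs.
apply: (Rmult_le_reg_l t); first lra.
move: h2 h3; rewrite /q !vdotE; nra.
Qed.

(** The mean value theorem on the segment gives the gradient at an intermediate point, within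
    [L |y - x|] of [g x]; hence the constant [L] where integration would give [L / 2]. *)
Lemma lipschitz_grad_descent K f (g : vec m -> vec m) L x y : vconvex_set K -> K x -> K y ->
  (forall u, K u -> has_grad f (g u) u) -> lipschitz_on K L g -> 0 <= L ->
  Rabs (f y - f x - vdot (g x) (vsub y x)) <= L * (vnorm (vsub y x) * vnorm (vsub y x)).
Proof.
move=> cvxK Kx Ky grad lip L0.
pose pt t := vadd (vscal t y) (vscal (1 - t) x).
have Kpt t : 0 <= t <= 1 -> K (pt t) by move=> t01; apply: cvxK.
have n0 := vnorm_ge0 (vsub y x).
have [||t [ft [t0 t1]]] := @MVT_cor2 (fun t => f (pt t)) (fun t => vdot (g (pt t)) (vsub y x)) 0 1.
- lra.
- move=> t t01 e e_gt0.
  pose D := vnorm (vsub y x) + 1.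
  have D0 : 0 < D by rewrite /D; lra.
  have iD0 : 0 < / D by apply: Rinv_0_lt_compat.
  have [d [d_gt0 dP]] := grad (pt t) (Kpt t t01) (e / 2 * / D) ltac:(apply: Rmult_lt_0_compat; lra).
  have dD : 0 < d * / D by apply: Rmult_lt_0_compat.
  exists (mkposreal _ dD) => h h_neq0 /= h_lt.
  have := dP (pt (t + h)).
  have -> : vsub (pt (t + h)) (pt t) = vscal h (vsub y x) by rewrite /pt; vec_ring.
  rewrite vnorm_scal vdot_scalr => hP.
  have h_abs : 0 < Rabs h by apply: Rabs_pos_lt.
  have hn : Rabs h * vnorm (vsub y x) < d.
    have : Rabs h * D < d * / D * D by apply: Rmult_lt_compat_r.
    have -> : d * / D * D = d by field; lra.
    by rewrite /D; nra.
  have {}hP := hP hn.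
  have -> : (f (pt (t + h)) - f (pt t)) / h - vdot (g (pt t)) (vsub y x) =
     (f (pt (t + h)) - f (pt t) - h * vdot (g (pt t)) (vsub y x)) * / h by field.
  rewrite Rabs_mult Rabs_inv.
  apply: (Rmult_lt_reg_r (Rabs h)) => //.
  rewrite Rmult_assoc Rinv_l ?Rmult_1_r; last lra.
  apply: Rle_lt_trans hP _.
  have : / D * vnorm (vsub y x) <= 1.
    apply: (Rmult_le_reg_l D) => //; rewrite -Rmult_assoc Rinv_r; last lra.
    by rewrite /D; lra.
  move=> h1; have eh : 0 < e * Rabs h by apply: Rmult_lt_0_compat.
  have := Rmult_le_compat_l _ _ _ (Rlt_le _ _ eh) h1; lra.
have pt1 : pt 1 = y by rewrite /pt; vec_ring.
have pt0 : pt 0 = x by rewrite /pt; vec_ring.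
rewrite pt1 pt0 Rminus_0_r Rmult_1_r in ft.
rewrite ft -vdot_subl.
have t01 : 0 <= t <= 1 by lra.
have := lip _ _ (Kpt t t01) Kx.
have -> : vsub (pt t) x = vscal t (vsub y x) by rewrite /pt; vec_ring.
rewrite vnorm_scal_ge0 => [lipt|]; last lra.
have bnd : vnorm (vsub (g (pt t)) (g x)) * vnorm (vsub y x) <=
    L * (vnorm (vsub y x) * vnorm (vsub y x)).
  rewrite -Rmult_assoc; apply: Rmult_le_compat_r => //.
  apply: Rle_trans lipt _; apply: Rmult_le_compat_l => //; nra.
apply: Rabs_le; split.
  by have := cauchy_schwarz_opp (vsub (g (pt t)) (g x)) (vsub y x); lra.
by have := cauchy_schwarz (vsub (g (pt t)) (g x)) (vsub y x); lra.
Qed.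

End ConvexFunctions.

(** * Consensus *)

Section Mixing.
Variables (m I : nat).
Implicit Types (A Q : 'I_I -> 'I_I -> R) (u v : 'I_I -> vec m).

(** Pairwise distances do not change when all entries move by the same vector, which
    [disagreement_mix_pos] exploits. *)
Definition disagreement v := \rsum_(i < I) \rsum_(j < I) vnorm (vsub (v i) (v j)).

Definition mix A v : 'I_I -> vec m := fun i => vsumI (fun j => vscal (A i j) (v j)).

(** The common sum [q] is free so that a doubly stochastic matrix with a constant subtracted from
    all entries still qualifies. *)
Definition bistochastic q A :=
  [/\ forall i j, 0 <= A i j, forall i, \rsum_(j < I) A i j = q
    & forall j, \rsum_(i < I) A i j = q].

Lemma mixE A v i k : mix A v i k = \rsum_(j < I) (A i j * v j k).
Proof. by []. Qed.

Lemma mix_mix A Q v : mix A (mix Q v) = mix (fun i j => \rsum_(l < I) (A i l * Q l j)) v.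
Proof.
apply: functional_extensionality => i; apply: functional_extensionality => k.
rewrite !mixE (@rsum_eq _ _ (fun l => \rsum_(j < I) (A i l * (Q l j * v j k)))); last first.
  by move=> l; rewrite mixE -rsum_mull.
rewrite rsum_exchange; apply: rsum_eq => j.
by rewrite -rsum_mulr; apply: rsum_eq => l; ring.
Qed.

Lemma mix_add A u v : mix A (fun i => vadd (u i) (v i)) = (fun i => vadd (mix A u i) (mix A v i)).
Proof.
apply: functional_extensionality => i; apply: functional_extensionality => k.
by rewrite /vadd !mixE -rsum_add; apply: rsum_eq => j; ring.
Qed.

Lemma bistochastic_mul q A Q : bistochastic 1 A -> bistochastic q Q ->
  bistochastic q (fun i j => \rsum_(l < I) (A i l * Q l j)).
Proof.
move=> [A0 Ar Ac] [Q0 Qr Qc]; split.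
- by move=> i j; apply: rsum_ge0 => l; apply: Rmult_le_pos.
- move=> i; rewrite rsum_exchange (@rsum_eq _ _ (fun l => A i l * q)).
    by rewrite rsum_mulr Ar Rmult_1_l.
  by move=> l; rewrite rsum_mull Qr.
- move=> j; rewrite rsum_exchange (@rsum_eq _ _ (fun l => 1 * Q l j)).
    by rewrite rsum_mull Qc Rmult_1_l.
  by move=> l; rewrite rsum_mulr Ac.
Qed.

Lemma disagreement_ge0 v : 0 <= disagreement v.
Proof. by apply: rsum_ge0 => i; apply: rsum_ge0 => j; apply: vnorm_ge0. Qed.

Lemma disagreement_row v i : \rsum_(j < I) vnorm (vsub (v i) (v j)) <= disagreement v.
Proof.
apply: (@rsum_ge_term _ (fun i => \rsum_(j < I) vnorm (vsub (v i) (v j)))) => l.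
by apply: rsum_ge0 => j; apply: vnorm_ge0.
Qed.

Lemma disagreement_add u v :
  disagreement (fun i => vadd (u i) (v i)) <= disagreement u + disagreement v.
Proof.
rewrite -rsum_add; apply: rsum_le => i; rewrite -rsum_add; apply: rsum_le => j.
apply: Rle_trans (vnorm_triangle _ _).
by right; congr vnorm; vec_ring.
Qed.

Lemma disagreement_le v : disagreement v <= 2 * INR I * \rsum_(i < I) vnorm (v i).
Proof.
apply: (Rle_trans _ (\rsum_(i < I) \rsum_(j < I) (vnorm (v i) + vnorm (v j)))).
  by apply: rsum_le => i; apply: rsum_le => j; apply: vnorm_sub_le.
right; rewrite (@rsum_eq _ _ (fun i => INR I * vnorm (v i) + \rsum_(j < I) vnorm (v j))).
  by rewrite rsum_add rsum_mull rsum_const; ring.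
by move=> i; rewrite rsum_add rsum_const.
Qed.

(** As rows sum to [q], [q] times the difference of entries [i], [j] of [mix Q v] is the sum of
    [Q i l * Q j l'] times [v l - v l']. Summing norms over [i] and [j], the column sums give
    [q^2]. *)
Lemma disagreement_mix q Q v : 0 < q -> bistochastic q Q ->
  disagreement (mix Q v) <= q * disagreement v.
Proof.
move=> q_gt0 [Q0 Qr Qc].
have pair i j : q * vnorm (vsub (mix Q v i) (mix Q v j)) <=
    \rsum_(l < I) \rsum_(l' < I) (Q i l * Q j l' * vnorm (vsub (v l) (v l'))).
  rewrite -vnorm_scal_ge0; last lra.
  have -> : vscal q (vsub (mix Q v i) (mix Q v j)) =
      vsumI (fun l => vsumI (fun l' => vscal (Q i l * Q j l') (vsub (v l) (v l')))).
    apply: functional_extensionality => k; rewrite /vscal /vsub !mixE.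
    change (q * (\rsum_(l < I) (Q i l * v l k) - \rsum_(l < I) (Q j l * v l k)) =
      \rsum_(l < I) \rsum_(l' < I) (Q i l * Q j l' * (v l k - v l' k))).
    rewrite [RHS](@rsum_eq _ _ (fun l => q * (Q i l * v l k)
      - Q i l * \rsum_(l' < I) (Q j l' * v l' k))).
      by rewrite rsum_sub rsum_mull rsum_mulr Qr; ring.
    move=> l; rewrite -(Qr j) -rsum_mulr -rsum_mull -rsum_sub.
    by apply: rsum_eq => l'; ring.
  apply: Rle_trans (vnorm_sum _) _; apply: rsum_le => l.
  apply: Rle_trans (vnorm_sum _) _; apply: rsum_le => l'.
  by rewrite vnorm_scal_ge0; [right | apply: Rmult_le_pos].
apply: (Rmult_le_reg_l q) => //; rewrite /disagreement -rsum_mull.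
apply: (Rle_trans _ (\rsum_(i < I) \rsum_(j < I)
    \rsum_(l < I) \rsum_(l' < I) (Q i l * Q j l' * vnorm (vsub (v l) (v l'))))).
  by apply: rsum_le => i; rewrite -rsum_mull; apply: rsum_le => j.
right.
rewrite (@rsum_eq _ _ (fun i => \rsum_(l < I) \rsum_(l' < I)
    (Q i l * (q * vnorm (vsub (v l) (v l')))))); last first.
  move=> i; rewrite rsum_exchange; apply: rsum_eq => l.
  rewrite rsum_exchange; apply: rsum_eq => l'.
  by rewrite -(Qc l') -rsum_mulr -rsum_mull; apply: rsum_eq => j; ring.
rewrite rsum_exchange -!rsum_mull; apply: rsum_eq => l.
rewrite rsum_exchange -!rsum_mull; apply: rsum_eq => l'.
by rewrite rsum_mulr Qc.
Qed.

(** Subtracting [d] from every entry of [A] moves all mixed vectors equally and lowers the row and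
    column sums to [1 - INR I * d]. *)
Lemma disagreement_mix_pos d A v : 0 <= d -> INR I * d < 1 -> bistochastic 1 A ->
  (forall i j, d <= A i j) -> disagreement (mix A v) <= (1 - INR I * d) * disagreement v.
Proof.
move=> d0 d1 [A0 Ar Ac] A_ge.
pose Q i j := A i j - d.
have QB : bistochastic (1 - INR I * d) Q.
  split=> [i j|i|j]; first by have := A_ge i j; rewrite /Q; lra.
    by rewrite rsum_sub Ar rsum_const.
  by rewrite rsum_sub Ac rsum_const.
have <- : disagreement (mix Q v) = disagreement (mix A v).
  apply: rsum_eq => i; apply: rsum_eq => j; congr vnorm.
  apply: functional_extensionality => k; rewrite /vsub !mixE -!rsum_sub.
  transitivity (\rsum_(l < I) ((A i l * v l k - A j l * v l k))); last by [].
  by apply: rsum_eq => l; rewrite /Q; ring.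
by apply: disagreement_mix => //; lra.
Qed.

End Mixing.

Lemma clos_refl_trans_exit T (R : relation T) (P : T -> Prop) a b :
  clos_refl_trans T R a b -> P a -> ~ P b -> exists c d, [/\ R c d, P c & ~ P d].
Proof.
elim=> [c d Rcd Pc Pd|c Pc|c d e _ IH1 _ IH2 Pc Pe]; [by exists c, d | by [] |].
by have [Pd|Pd] := classic (P d); [apply: IH2 | apply: IH1].
Qed.

Lemma bernoulli_sub s n : 0 <= s <= 1 -> 1 - INR n * s <= (1 - s) ^ n.
Proof.
move=> s01; elim: n => [|n IHn]; first by rewrite /=; lra.
rewrite S_INR -tech_pow_Rmult.
have := pos_INR n => n0.
have ns : 0 <= INR n * s by apply: Rmult_le_pos; lra.
have := Rmult_le_compat_l (1 - s) _ _ ltac:(lra) IHn; nra.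
Qed.

(** * Joint connectivity and a seminorm contracted by each mixing step *)

Section Consensus.
Variables (m I : nat) (E : nat -> 'I_I -> 'I_I -> Prop) (W : nat -> 'I_I -> 'I_I -> R).
Variables (vartheta : R) (B : nat).
Hypotheses (I_gt0 : (0 < I)%N) (vartheta01 : 0 < vartheta < 1) (B_gt0 : (0 < B)%N).
Hypothesis W_bist : forall n, bistochastic 1 (W n).
Hypothesis W_self : forall n i, vartheta <= W n i i.
Hypothesis W_edge : forall n i j, E n j i -> vartheta <= W n i j.
Hypothesis connected : forall k : nat, strongly_connected (fun j i => exists n : nat,
  (k * B <= n)%N /\ (n <= (k + 1) * B - 1)%N /\ E n j i).

(** The product [W (n + t - 1) ... W n], latest factor on the left. *)
Fixpoint wprod n t : 'I_I -> 'I_I -> R :=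
  if t is t'.+1 then fun i j => \rsum_(l < I) (W (n + t')%N i l * wprod n t' l j)
  else fun i j => if i == j then 1 else 0.

Lemma wprod_bist n t : bistochastic 1 (wprod n t).
Proof.
elim: t => [|t IHt] /=; last exact: bistochastic_mul.
have delta (i : 'I_I) : \rsum_(j < I) (if i == j then 1 else 0) = 1.
  rewrite /rsumI (bigD1 i) //= eqxx big1 ?Rplus_0_r // => j.
  by rewrite eq_sym => /negbTE ->.
split=> [i j|i|j]; [by case: eqP => _; lra | exact: delta |].
by rewrite -[RHS](delta j); apply: rsum_eq => i; rewrite eq_sym.
Qed.

Lemma wprod_step n t i l j : 0 <= vartheta ^ t <= wprod n t l j -> vartheta <= W (n + t)%N i l ->
  vartheta ^ t.+1 <= wprod n t.+1 i j.
Proof.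
move=> [p0 le_p] le_W.
apply: (Rle_trans _ (W (n + t)%N i l * wprod n t l j)).
  by rewrite -tech_pow_Rmult; apply: Rmult_le_compat => //; lra.
apply: (@rsum_ge_term _ (fun l => W (n + t)%N i l * wprod n t l j)) => l'.
have [W0 _ _] := W_bist (n + t); have [P0 _ _] := wprod_bist n t.
exact: Rmult_le_pos.
Qed.

Let pow_ge0 t : 0 <= vartheta ^ t.
Proof. by apply: pow_le; lra. Qed.

(** The agents on which the value of [j] at time [n] weighs at least [vartheta ^ t] after [t] steps.
    The threshold drops by the factor that a self-loop or an edge guarantees, so these sets grow
    with [t]. *)
Definition reached n j t : {set 'I_I} :=
  [set i | if Rle_dec (vartheta ^ t) (wprod n t i j) then true else false].

Lemma reachedP n j t i : reflect (vartheta ^ t <= wprod n t i j) (i \in reached n j t).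
Proof. by rewrite inE; case: Rle_dec => h; constructor. Qed.

Lemma reached_mono n j t s : (t <= s)%N -> reached n j t \subset reached n j s.
Proof.
move=> /subnKC <-; elim: (s - t)%N => [|d IHd]; first by rewrite addn0.
apply: subset_trans IHd _; apply/subsetP => i /reachedP le_i; apply/reachedP.
by rewrite addnS; apply: (wprod_step (l := i)).
Qed.

(** Some edge active during the window leaves the set reached at its start. By monotonicity its tail
    is still reached when the edge is active, so its head joins one step later. *)
Lemma reached_window n j k : (n <= k * B)%N -> reached n j (k * B - n) != setT ->
  (#|reached n j (k * B - n)| < #|reached n j (k.+1 * B - n)|)%N.
Proof.
move=> le_n not_all; set S := reached n j (k * B - n).
have jS : j \in S.
  apply: (subsetP (reached_mono n j (leq0n _))); apply/reachedP => /=.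
  by rewrite eqxx; lra.
have [i iS] : exists i, i \notin S.
  apply: NNPP => none; move/negP: not_all; apply.
  rewrite eqEsubset subsetT; apply/subsetP => i _; apply: NNPP => /negP iS.
  by apply: none; exists i.
have [a [b [[t [t_ge [t_le Eab]]] aS /negP bS]]] :=
  clos_refl_trans_exit (P := fun a => a \in S) (@connected k j i) jS (negP iS).
have le_nt : (n <= t)%N by apply: leq_trans t_ge.
have lt_t : (t < k.+1 * B)%N.
  by move: t_le; rewrite addn1 -ltnS subn1 prednK ?muln_gt0.
apply: proper_card; apply/properP; split.
  by apply: reached_mono; apply: leq_sub2r; rewrite leq_mul2r leqnSn orbT.
exists b => //; have le1 : ((t - n).+1 <= k.+1 * B - n)%N by rewrite -subSn //; apply: leq_sub2r.
apply: (subsetP (reached_mono n j le1)); apply/reachedP.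
apply: (wprod_step (l := a)); last by rewrite subnKC //; apply: W_edge.
split=> //; apply/reachedP; apply: (subsetP (reached_mono n j _)) aS.
exact: leq_sub2r.
Qed.

(** At most [B] steps lead from any time to the start of a window; then each window reaches at least
    one further agent until none is left. *)
Definition horizon := (I.+1 * B)%N.

Lemma wprod_positive n i j : vartheta ^ horizon <= wprod n horizon i j.
Proof.
(* The first window that starts strictly after [n]. *)
pose k0 := (n %/ B).+1.
have n_lt : (n < k0 * B)%N by rewrite ltn_ceil.
have k0_le : (k0 * B <= n + B)%N by rewrite mulSn addnC leq_add2r leq_trunc_div.
have grow c : (c < I)%N -> (c < #|reached n j ((k0 + c) * B - n)|)%N.
  elim: c => [|c IHc] c_lt.
    apply/card_gt0P; exists j; apply: (subsetP (reached_mono n j (leq0n _))).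
    by apply/reachedP => /=; rewrite eqxx; lra.
  have {IHc}IHc := IHc (ltnW c_lt); rewrite addnS.
  have le_n : (n <= (k0 + c) * B)%N.
    by apply: leq_trans (ltnW n_lt) _; rewrite leq_mul2r leq_addr orbT.
  have [full|not_full] := eqVneq (reached n j ((k0 + c) * B - n)) setT.
    apply: (leq_trans (n := #|reached n j ((k0 + c) * B - n)|)).
      by rewrite full cardsT card_ord.
    apply: subset_leq_card; apply: reached_mono; apply: leq_sub2r.
    by rewrite leq_mul2r leqnSn orbT.
  exact: leq_ltn_trans IHc (reached_window le_n not_full).
have full : reached n j ((k0 + I.-1) * B - n) = setT.
  apply/eqP; rewrite eqEcard subsetT cardsT card_ord.
  by have := grow I.-1; rewrite prednK //; apply.
apply/reachedP.
have le_h : ((k0 + I.-1) * B - n <= horizon)%N.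
  rewrite leq_subLR mulnDl; apply: (leq_trans (n := (n + B + I.-1 * B)%N)).
    by rewrite leq_add2r.
  rewrite -addnA leq_add2l /horizon -mulSn prednK // leq_mul2r leqnSn orbT //.
by apply: (subsetP (reached_mono n j le_h)); rewrite full inE.
Qed.

Definition mixes n t (v : 'I_I -> vec m) := mix (wprod n t) v.

Lemma mixes0 n v : mixes n 0 v = v.
Proof.
apply: functional_extensionality => i; apply: functional_extensionality => k.
rewrite /mixes mixE /rsumI (bigD1 i) //= eqxx big1 ?Rplus_0_r ?Rmult_1_l // => j.
by rewrite eq_sym => /negbTE ->; ring.
Qed.

Lemma mixesS n t v : mixes n t.+1 v = mix (W (n + t)%N) (mixes n t v).
Proof. by rewrite /mixes mix_mix. Qed.

Lemma mixesSl n t v : mixes n t.+1 v = mixes n.+1 t (mix (W n) v).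
Proof.
elim: t => [|t IHt]; first by rewrite mixesS !mixes0 addn0.
by rewrite mixesS IHt mixesS addnS addSn.
Qed.

Let q := 1 - vartheta ^ horizon / 2.
(** A substitute for the [horizon]-th root of [q]: Bernoulli's inequality gives
    [q <= rho ^ horizon]. *)
Let rho := 1 - (1 - q) / INR horizon.

Let horizon_gt0 : (0 < horizon)%N.
Proof. by rewrite /horizon muln_gt0. Qed.

Let horizon_ge1 : 1 <= INR horizon.
Proof. by have /leP/le_INR := horizon_gt0. Qed.

Let pow_h : 0 < vartheta ^ horizon < 1.
Proof.
split; first by apply: pow_lt; lra.
by have [|_] := @pow_lt_1_compat vartheta horizon ltac:(lra); first exact/ltP.
Qed.

Let rho01 : 0 < rho < 1.
Proof.
have iv : 0 < / INR horizon <= 1.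
  split; first by apply: Rinv_0_lt_compat; lra.
  by rewrite -Rinv_1; apply: Rinv_le_contravar; lra.
by rewrite /rho /q /Rdiv; nra.
Qed.

Let q_le : q <= rho ^ horizon.
Proof.
have s01 : 0 <= (1 - q) / INR horizon <= 1 by have := rho01; rewrite /rho; lra.
have := bernoulli_sub horizon s01.
have -> : INR horizon * ((1 - q) / INR horizon) = 1 - q by field; lra.
by rewrite -/rho; lra.
Qed.

Lemma disagreement_mixes n t v : disagreement (mixes n t v) <= disagreement v.
Proof.
have := disagreement_mix v Rlt_0_1 (wprod_bist n t); rewrite Rmult_1_l; exact.
Qed.

Lemma disagreement_horizon n v : disagreement (mixes n horizon v) <= q * disagreement v.
Proof.
have I0 : 0 < INR I by apply: lt_0_INR; apply/ltP.
pose d := vartheta ^ horizon / 2 / INR I.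
have Id : INR I * d = vartheta ^ horizon / 2 by rewrite /d; field; lra.
have I1 : 1 <= INR I by have /leP/le_INR := I_gt0.
have d0 : 0 <= d by apply: Rmult_le_pos; [lra | left; apply: Rinv_0_lt_compat].
rewrite /q -Id; apply: disagreement_mix_pos => //.
- by rewrite Id; lra.
- exact: wprod_bist.
move=> i j; apply: Rle_trans (wprod_positive n i j); nra.
Qed.

(** The usual adapted norm, turning a contraction over [horizon] steps into one per step: the coming
    disagreements are summed with geometric weights. *)
Definition lyapunov n v := \rsum_(t < horizon) ((/ rho) ^ t * disagreement (mixes n t v)).

Lemma irho_pow_ge0 t : 0 <= (/ rho) ^ t.
Proof. by apply: pow_le; left; apply: Rinv_0_lt_compat; lra. Qed.

(* Shifting the time window by one step multiplies the weights by [rho]; the new last term is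
   absorbed by the dropped first one thanks to the contraction over [horizon] steps. *)
Lemma lyapunov_contract n v : lyapunov n.+1 (mix (W n) v) <= rho * lyapunov n v.
Proof.
pose b t := (/ rho) ^ t * disagreement (mixes n t v).
have -> : lyapunov n.+1 (mix (W n) v) = rho * \rsum_(t < horizon) b t.+1.
  rewrite -rsum_mull; apply: rsum_eq => t; rewrite -mixesSl /b -tech_pow_Rmult.
  by field; lra.
apply: Rmult_le_compat_l; first lra.
have : b 0%N + \rsum_(t < horizon) b t.+1 = \rsum_(t < horizon) b t + b horizon.
  by rewrite -rsum_Sl rsum_S.
suff : b horizon <= b 0%N by rewrite -[lyapunov n v]/(\rsum_(t < horizon) b t); lra.
rewrite /b mixes0 pow_O Rmult_1_l.
have := disagreement_horizon n v; have := disagreement_ge0 v => S0 le_q.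
apply: (Rmult_le_reg_l (rho ^ horizon)); first by apply: pow_lt; lra.
rewrite -Rmult_assoc -Rpow_mult_distr Rinv_r ?pow1 ?Rmult_1_l; last lra.
by apply: Rle_trans le_q _; apply: Rmult_le_compat_r.
Qed.

Lemma lyapunov_ge n v : disagreement v <= lyapunov n v.
Proof.
pose b t := (/ rho) ^ t * disagreement (mixes n t v).
have -> : disagreement v = b (Ordinal horizon_gt0) by rewrite /b mixes0 /=; ring.
apply: (@rsum_ge_term _ (fun t : 'I_horizon => b t)) => t.
by apply: Rmult_le_pos; [exact: irho_pow_ge0 | exact: disagreement_ge0].
Qed.

Lemma lyapunov_le n v : lyapunov n v <= (\rsum_(t < horizon) (/ rho) ^ t) * disagreement v.
Proof.
rewrite -rsum_mulr; apply: rsum_le => t.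
by apply: Rmult_le_compat_l; [exact: irho_pow_ge0 | exact: disagreement_mixes].
Qed.

Lemma lyapunov_add n u v :
  lyapunov n (fun i => vadd (u i) (v i)) <= lyapunov n u + lyapunov n v.
Proof.
rewrite -rsum_add; apply: rsum_le => t; rewrite -Rmult_plus_distr_l.
apply: Rmult_le_compat_l; first exact: irho_pow_ge0.
by rewrite /mixes mix_add; apply: disagreement_add.
Qed.

(** Besides double stochasticity, all that the analysis of the iteration uses about the network. [N]
    depends on time, but [rho] and [c] do not. *)
Lemma consensus_norm : exists rho c (N : nat -> ('I_I -> vec m) -> R),
  [/\ 0 <= rho < 1, 0 <= c,
      forall n v, disagreement v <= N n v <= c * disagreement v,
      forall n u v, N n (fun i => vadd (u i) (v i)) <= N n u + N n v
    & forall n v, N n.+1 (mix (W n) v) <= rho * N n v].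
Proof.
exists rho, (\rsum_(t < horizon) (/ rho) ^ t), lyapunov; split.
- lra.
- by apply: rsum_ge0 => t; apply: irho_pow_ge0.
- by move=> n v; split; [exact: lyapunov_ge | exact: lyapunov_le].
- exact: lyapunov_add.
- exact: lyapunov_contract.
Qed.

End Consensus.

(** * Convergence of the iteration *)

Lemma mix_sub m I (A : 'I_I -> 'I_I -> R) (v : 'I_I -> vec m) i u : \rsum_(j < I) A i j = 1 ->
  vsub (mix A v i) u = vsumI (fun j => vscal (A i j) (vsub (v j) u)).
Proof.
move=> A1; apply: functional_extensionality => k.
rewrite /vsub mixE; transitivity (\rsum_(j < I) (A i j * v j k - A i j * u k)).
  by rewrite rsum_sub rsum_mulr A1 Rmult_1_l.
by apply: rsum_eq => j; rewrite /vscal; ring.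
Qed.

Lemma bistochastic_le1 I (A : 'I_I -> 'I_I -> R) i j : bistochastic 1 A -> 0 <= A i j <= 1.
Proof.
move=> [A0 Ar _]; split; first exact: A0.
by rewrite -(Ar i); apply: (@rsum_ge_term _ (fun j => A i j)).
Qed.

Definition average m I (v : 'I_I -> vec m) : vec m := vscal (/ INR I) (vsumI (fun i => v i)).

Section Next.
Variables (m I : nat) (K : vec m -> Prop) (f : 'I_I -> vec m -> R).
Variables (gradf : 'I_I -> vec m -> vec m) (G : vec m -> R) (W : nat -> 'I_I -> 'I_I -> R).
Variables (ftil : 'I_I -> vec m -> vec m -> R) (gradftil : 'I_I -> vec m -> vec m -> vec m).
Variables (alpha : nat -> R) (eps : 'I_I -> nat -> R).
Variables (x y pitil xtil xinx z : nat -> 'I_I -> vec m).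
Variables (L LF LG tau L3 Meps : R).
(* [N n] is a seminorm adapted to the mixing matrices from time [n] on, see [consensus_norm]. *)
Variables (rho c : R) (N : nat -> ('I_I -> vec m) -> R).
Hypothesis I_gt0 : (0 < I)%N.
Hypotheses (closedK : vclosed_set K) (convexK : vconvex_set K).
Hypothesis grad : forall i u, K u -> has_grad (f i) (gradf i u) u.
Hypotheses (L_ge0 : 0 <= L) (lip : forall i, lipschitz_on K L (gradf i)).
Hypothesis gradF_le : forall u, K u -> vnorm (vsumI (fun i => gradf i u)) <= LF.
Hypothesis convexG : vconvex_fun G.
Hypothesis subgradG_le : forall u xi, K u -> subgrad G u xi -> vnorm xi <= LG.
Hypothesis coercive : coercive_on K (fun u => rsumI (fun i => f i u) + G u).
Hypothesis W_bist : forall n, bistochastic 1 (W n).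
Hypothesis tau_gt0 : 0 < tau.
Hypothesis ftil_sc : forall i u, K u -> strongly_convex_on K tau (fun v => ftil i v u).
Hypothesis ftil_grad : forall i u v, K u -> K v ->
  has_grad_rel K (fun w => ftil i w u) (gradftil i v u) v.
Hypothesis ftil_consistent : forall i u, K u -> gradftil i u u = gradf i u.
Hypothesis L3_ge0 : 0 <= L3.
Hypothesis ftil_lip : forall i v, K v -> lipschitz_on K L3 (gradftil i v).
Hypothesis x0K : forall i, K (x 0%N i).
Hypothesis y0E : forall i, y 0%N i = gradf i (x 0%N i).
Hypothesis pitilE : forall n i, pitil n i = vsub (vscal (INR I) (y n i)) (gradf i (x n i)).
Hypothesis xtilP : forall n i, K (xtil n i) /\ forall w, K w ->
  ftil i (xtil n i) (x n i) + vdot (pitil n i) (vsub (xtil n i) (x n i)) + G (xtil n i)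
    <= ftil i w (x n i) + vdot (pitil n i) (vsub w (x n i)) + G w.
Hypothesis xinxP : forall n i, K (xinx n i) /\ vnorm (vsub (xinx n i) (xtil n i)) <= eps i n.
Hypothesis zE : forall n i, z n i = vadd (x n i) (vscal (alpha n) (vsub (xinx n i) (x n i))).
Hypothesis xS : forall n i, x n.+1 i = vsumI (fun j => vscal (W n i j) (z n j)).
Hypothesis yS : forall n i, y n.+1 i =
  vadd (vsumI (fun j => vscal (W n i j) (y n j))) (vsub (gradf i (x n.+1 i)) (gradf i (x n i))).
Hypothesis eps_ge0 : forall i n, 0 <= eps i n.
Hypothesis eps_le : forall n, \rsum_(i < I) eps i n <= Meps.
Hypothesis alpha01 : forall n, 0 < alpha n <= 1.
Hypothesis alpha_unbounded : ~ bounded_sums alpha.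
Hypothesis alpha2_sum : bounded_sums (fun n => alpha n * alpha n).
Hypothesis eps_sum : bounded_sums (fun n => alpha n * \rsum_(i < I) eps i n).
Hypotheses (rho01 : 0 <= rho < 1) (c_ge0 : 0 <= c).
Hypothesis N_equiv : forall n v, disagreement v <= N n v <= c * disagreement v.
Hypothesis N_add : forall n u v, N n (fun i => vadd (u i) (v i)) <= N n u + N n v.
Hypothesis N_mix : forall n v, N n.+1 (mix (W n) v) <= rho * N n v.

Notation xbar n := (average (x n)).
Notation gradF u := (vsumI (fun i => gradf i u)).
Notation Iy n i := (vscal (INR I) (y n i)).
Let F u := \rsum_(i < I) f i u.
Let dir n i := vsub (xtil n i) (x n i).
Let step n i := vsub (xinx n i) (x n i).
Let delta n := \rsum_(i < I) vnorm (dir n i).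
Let steps n := \rsum_(i < I) vnorm (step n i).
Let epss n := \rsum_(i < I) eps i n.
Let a n := N n (x n).
Let b n := N n (y n).
Let u n := a n + b n.
Let track n := disagreement (y n) + L * disagreement (x n).

Let I_ge1 : 1 <= INR I.
Proof. by have /leP/le_INR := I_gt0. Qed.

Let alpha_ge0 n : 0 <= alpha n.
Proof. by have := alpha01 n; lra. Qed.

(** * Feasibility, averages and gradient tracking *)

Lemma z_segment n i : z n i = vadd (vscal (alpha n) (xinx n i)) (vscal (1 - alpha n) (x n i)).
Proof. by rewrite zE vadd_segment. Qed.

Lemma x_in n i : K (x n i).
Proof.
elim: n i => [|n IHn] i; first exact: x0K.
have [W0 Wr _] := W_bist n.
rewrite xS; apply: convex_set_comb => // j.
rewrite z_segment; apply: convexK => //; first by case: (xinxP n j).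
by have := alpha01 n; lra.
Qed.

Lemma xtil_in n i : K (xtil n i). Proof. by case: (xtilP n i). Qed.

Lemma xinx_in n i : K (xinx n i). Proof. by case: (xinxP n i). Qed.

Lemma xbar_in n : K (xbar n).
Proof.
have -> : xbar n = vsumI (fun i => vscal (/ INR I) (x n i)).
  by apply: functional_extensionality => k; rewrite /average /vscal -[RHS]/(rsumI _) rsum_mull.
apply: convex_set_comb => //; last by move=> i; apply: x_in.
  by move=> _; left; apply: Rinv_0_lt_compat; lra.
by rewrite rsum_const; field; lra.
Qed.

Lemma LF_ge0 : 0 <= LF.
Proof. by apply: Rle_trans (gradF_le (xbar_in 0)); apply: vnorm_ge0. Qed.

Lemma LG_ge0 : 0 <= LG.
Proof.
have [xi xiP] := subgrad_exists (xbar 0) convexG.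
by apply: Rle_trans (subgradG_le (xbar_in 0) xiP); apply: vnorm_ge0.
Qed.

Let G_lip := convex_lipschitz convexG subgradG_le.

Lemma sub_average_le (v : 'I_I -> vec m) i :
  vnorm (vsub (v i) (average v)) <= / INR I * \rsum_(j < I) vnorm (vsub (v i) (v j)).
Proof.
have iI : 0 < / INR I by apply: Rinv_0_lt_compat; lra.
have -> : vsub (v i) (average v) = vscal (/ INR I) (vsumI (fun j => vsub (v i) (v j))).
  apply: functional_extensionality => k; rewrite /average /vsub /vscal.
  transitivity (/ INR I * \rsum_(j < I) (v i k - v j k)); last by [].
  rewrite rsum_sub rsum_const Rmult_minus_distr_l -Rmult_assoc Rinv_l; last lra.
  by rewrite Rmult_1_l.
rewrite vnorm_scal_ge0; last lra.
by apply: Rmult_le_compat_l; [lra | apply: vnorm_sum].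
Qed.

Lemma sum_sub_average_le (v : 'I_I -> vec m) :
  \rsum_(i < I) vnorm (vsub (v i) (average v)) <= disagreement v.
Proof.
apply: (Rle_trans _ (\rsum_(i < I) (/ INR I * \rsum_(j < I) vnorm (vsub (v i) (v j))))).
  by apply: rsum_le => i; apply: sub_average_le.
rewrite rsum_mull -/(disagreement v).
have : / INR I <= 1 by rewrite -Rinv_1; apply: Rinv_le_contravar; lra.
by have := disagreement_ge0 v; nra.
Qed.

Lemma sub_average_le_disagreement (v : 'I_I -> vec m) i :
  vnorm (vsub (v i) (average v)) <= disagreement v.
Proof.
apply: Rle_trans (sum_sub_average_le v).
by apply: (@rsum_ge_term _ (fun i => vnorm (vsub (v i) (average v)))) => j; apply: vnorm_ge0.
Qed.

Lemma x_mix n : x n.+1 = mix (W n) (z n).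
Proof. by apply: functional_extensionality => i; rewrite xS. Qed.

Lemma mix_sum (A : 'I_I -> 'I_I -> R) (v : 'I_I -> vec m) : bistochastic 1 A ->
  vsumI (mix A v) = vsumI v.
Proof.
move=> [_ _ Ac]; apply: functional_extensionality => k.
transitivity (\rsum_(i < I) \rsum_(j < I) (A i j * v j k)); first by [].
rewrite rsum_exchange; apply: rsum_eq => j.
by rewrite rsum_mulr Ac Rmult_1_l.
Qed.

(** The invariant behind tracking: mixing preserves totals, and the gradient increments telescope
    from the initialization. *)
Lemma y_sum n : vsumI (y n) = vsumI (fun i => gradf i (x n i)).
Proof.
elim: n => [|n IHn]; first by apply: vsum_eq => i; rewrite y0E.
have -> : vsumI (y n.+1) =
    vadd (vsumI (mix (W n) (y n))) (vsumI (fun i => vsub (gradf i (x n.+1 i)) (gradf i (x n i)))).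
  apply: functional_extensionality => k; rewrite /vadd -[RHS]rsum_add.
  by apply: rsum_eq => i; rewrite yS.
rewrite mix_sum // IHn; apply: functional_extensionality => k.
rewrite /vadd -[LHS]rsum_add; apply: rsum_eq => i; rewrite /vsub; ring.
Qed.

Lemma gradF_lip v w : K v -> K w ->
  vnorm (vsub (gradF v) (gradF w)) <= INR I * L * vnorm (vsub v w).
Proof.
move=> Kv Kw.
have -> : vsub (gradF v) (gradF w) = vsumI (fun i => vsub (gradf i v) (gradf i w)).
  by apply: functional_extensionality => k; rewrite /vsub -[RHS]/(rsumI _) rsum_sub.
apply: Rle_trans (vnorm_sum _) _; rewrite Rmult_assoc -rsum_const.
by apply: rsum_le => i; apply: lip.
Qed.

(** Passing from [I y_i] to the sum of the [y_j] costs the disagreement of [y]. That sum is the sum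
    of the local gradients, and moving these to the average costs [L] times the disagreement of
    [x]. *)
Lemma tracking n i : vnorm (vsub (Iy n i) (gradF (xbar n))) <= track n.
Proof.
apply: Rle_trans (vnorm_sub_triangle (vsumI (y n)) _ _) _; apply: Rplus_le_compat.
  have -> : vsub (Iy n i) (vsumI (y n)) = vsumI (fun j => vsub (y n i) (y n j)).
    apply: functional_extensionality => k.
    by rewrite /vsub /vscal -[RHS]/(rsumI _) rsum_sub rsum_const.
  by apply: Rle_trans (vnorm_sum _) (disagreement_row _ _).
rewrite y_sum.
have -> : vsub (vsumI (fun j => gradf j (x n j))) (gradF (xbar n)) =
    vsumI (fun j => vsub (gradf j (x n j)) (gradf j (xbar n))).
  by apply: functional_extensionality => k; rewrite /vsub -[RHS]/(rsumI _) rsum_sub.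
apply: Rle_trans (vnorm_sum _) _.
apply: (Rle_trans _ (\rsum_(j < I) (L * vnorm (vsub (x n j) (xbar n))))).
  by apply: rsum_le => j; apply: lip; [exact: x_in | exact: xbar_in].
by rewrite rsum_mull; apply: Rmult_le_compat_l => //; apply: sum_sub_average_le.
Qed.

Lemma Iy_le n i : vnorm (Iy n i) <= LF + track n.
Proof.
have := vnorm_le_add (Iy n i) (gradF (xbar n)).
by have := tracking n i; have := gradF_le (xbar_in n); lra.
Qed.

Lemma best_response_variational n i w : K w ->
  0 <= vdot (vadd (gradftil i (xtil n i) (x n i)) (pitil n i)) (vsub w (xtil n i))
       + (G w - G (xtil n i)).
Proof.
move=> Kw; have [Kt min] := xtilP n i.
apply: (argmin_variational convexK convexG Kt _ min Kw).
by apply: ftil_grad => //; apply: x_in.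
Qed.

Lemma gradf_pitil n i : vadd (gradf i (x n i)) (pitil n i) = Iy n i.
Proof. by rewrite pitilE; vec_ring. Qed.

(** The variational inequality tested at [x n i], plus strong monotonicity of the surrogate gradient
    between [x n i] and [xtil n i]; consistency turns the gradient at [x n i] plus [pitil] into
    [I y_i]. *)
Lemma descent_direction n i :
  vdot (Iy n i) (dir n i) + (G (xtil n i) - G (x n i)) <= - (tau * vnorm (dir n i) ^ 2).
Proof.
have Kx := x_in n i; have Kt := xtil_in n i.
have vi := best_response_variational n i Kx.
have := strongly_monotone_grad convexK tau_gt0 (ftil_sc i Kx) (ftil_grad i Kx Kx)
  (ftil_grad i Kx Kt) Kx Kt.
rewrite ftil_consistent // -gradf_pitil -/(dir n i); move: vi; rewrite /dir !vdotE; lra.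
Qed.

(** [descent_direction] divided by the norm of [dir]. The presence of [track] is what forces the
    relative perturbation in the recursions. *)
Lemma dir_le n i : tau * vnorm (dir n i) <= LF + LG + track n.
Proof.
have := descent_direction n i; have := Iy_le n i.
have := G_lip (xtil n i) (x_in n i); rewrite (vnorm_subC (x n i)) -/(dir n i).
have := cauchy_schwarz_opp (Iy n i) (dir n i); have := vnorm_ge0 (dir n i).
set d := vnorm (dir n i) => d_ge0 cs lipG Iyn desc.
have h : tau * d ^ 2 <= d * (LF + LG + track n).
  have : vnorm (Iy n i) * d <= (LF + track n) * d by apply: Rmult_le_compat_r.
  lra.
have [d_gt0|<-] := d_ge0.
  by apply: (Rmult_le_reg_l d) => //; lra.
rewrite Rmult_0_r; have := vnorm_ge0 (Iy n i); have := LG_ge0; lra.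
Qed.

Lemma step_le n i : vnorm (step n i) <= vnorm (dir n i) + eps i n.
Proof.
have := vnorm_sub_triangle (xtil n i) (xinx n i) (x n i).
by have [_] := xinxP n i; rewrite /step /dir; lra.
Qed.

Lemma steps_le n : steps n <= delta n + epss n.
Proof. by rewrite -rsum_add; apply: rsum_le => i; apply: step_le. Qed.

(** * Coupled recursion of the two disagreements *)

Let steps_ge0 n : 0 <= steps n.
Proof. by apply: rsum_ge0 => i; apply: vnorm_ge0. Qed.

Let delta_ge0 n : 0 <= delta n.
Proof. by apply: rsum_ge0 => i; apply: vnorm_ge0. Qed.

Let epss_ge0 n : 0 <= epss n.
Proof. by apply: rsum_ge0 => i; apply: eps_ge0. Qed.

Let dx_le n : 0 <= disagreement (x n) <= a n.
Proof. by split; [apply: disagreement_ge0 | case: (N_equiv n (x n))]. Qed.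

Let dy_le n : 0 <= disagreement (y n) <= b n.
Proof. by split; [apply: disagreement_ge0 | case: (N_equiv n (y n))]. Qed.

Let track_le n : 0 <= track n <= L * a n + b n.
Proof.
have [x0 xa] := dx_le n; have [y0 yb] := dy_le n.
have := Rmult_le_compat_l L _ _ L_ge0 xa; have := Rmult_le_pos L _ L_ge0 x0.
by rewrite /track; lra.
Qed.

Let N_le n (v : 'I_I -> vec m) : N n v <= c * (2 * INR I * \rsum_(i < I) vnorm (v i)).
Proof.
have [_ le_c] := N_equiv n v; apply: Rle_trans le_c _.
by apply: Rmult_le_compat_l => //; apply: disagreement_le.
Qed.

Lemma a_rec n : a n.+1 <= rho * a n + 2 * c * INR I * (alpha n * steps n).
Proof.
rewrite /a x_mix; apply: Rle_trans (N_mix _ _) _.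
have -> : z n = fun i => vadd (x n i) (vscal (alpha n) (step n i)).
  by apply: functional_extensionality => i; rewrite zE.
have := N_add n (x n) (fun i => vscal (alpha n) (step n i)).
have := N_le n (fun i => vscal (alpha n) (step n i)).
have -> : \rsum_(i < I) vnorm (vscal (alpha n) (step n i)) = alpha n * steps n.
  by rewrite -rsum_mull; apply: rsum_eq => i; rewrite vnorm_scal_ge0.
move=> h1 h2.
have h3 : 0 <= c * (2 * INR I * (alpha n * steps n)).
  apply: Rmult_le_pos => //; apply: Rmult_le_pos; first lra.
  exact: Rmult_le_pos.
have := Rmult_le_compat_l rho _ _ ltac:(lra) h2.
nra.
Qed.

(** Mixing alone displaces agents by the order of their disagreement; this is the origin of the term
    of [b_rec] without [alpha]. *)
Lemma x_increment n i :
  vnorm (vsub (x n.+1 i) (x n i)) <= \rsum_(j < I) vnorm (vsub (x n i) (x n j)) + alpha n * steps n.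
Proof.
have [W0 Wr _] := W_bist n.
rewrite x_mix mix_sub //; apply: Rle_trans (vnorm_sum _) _.
rewrite -rsum_mull -rsum_add; apply: rsum_le => j.
have [w0 w1] := bistochastic_le1 i j (W_bist n).
rewrite vnorm_scal_ge0 // zE.
have -> : vsub (vadd (x n j) (vscal (alpha n) (vsub (xinx n j) (x n j)))) (x n i) =
   vadd (vsub (x n j) (x n i)) (vscal (alpha n) (step n j)) by rewrite /step; vec_ring.
apply: (Rle_trans _ (1 * vnorm (vadd (vsub (x n j) (x n i)) (vscal (alpha n) (step n j))))).
  by apply: Rmult_le_compat_r => //; apply: vnorm_ge0.
rewrite Rmult_1_l -vnorm_scal_ge0 // (vnorm_subC (x n i)); exact: vnorm_triangle.
Qed.

Lemma b_rec n : b n.+1 <= rho * b n + 2 * c * INR I * L * INR I * (a n + alpha n * steps n).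
Proof.
pose g i := vsub (gradf i (x n.+1 i)) (gradf i (x n i)).
have -> : b n.+1 = N n.+1 (fun i => vadd (mix (W n) (y n) i) (g i)).
  by congr (N n.+1); apply: functional_extensionality => i; rewrite yS.
apply: Rle_trans (N_add _ _ _) _; apply: Rplus_le_compat; first exact: N_mix.
apply: Rle_trans (N_le _ _) _.
have -> : 2 * c * INR I * L * INR I * (a n + alpha n * steps n) =
   c * (2 * INR I * (L * (INR I * (a n + alpha n * steps n)))) by ring.
apply: Rmult_le_compat_l => //; apply: Rmult_le_compat_l; first lra.
apply: (Rle_trans _ (\rsum_(i < I) (L * vnorm (vsub (x n.+1 i) (x n i))))).
  by apply: rsum_le => i; apply: lip; apply: x_in.
rewrite rsum_mull; apply: Rmult_le_compat_l => //.
apply: (Rle_trans _ (disagreement (x n) + INR I * (alpha n * steps n))).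
  by rewrite -rsum_const -rsum_add; apply: rsum_le => i; apply: x_increment.
have [x0 xa] := dx_le n; nra.
Qed.

Let c3 := INR I * / tau * (LF + LG + 1 + L) + Meps.

Let itau_gt0 : 0 < / tau.
Proof. exact: Rinv_0_lt_compat. Qed.

Let Meps_ge0 : 0 <= Meps.
Proof. by apply: Rle_trans (eps_le 0%N); apply: rsum_ge0 => i. Qed.

Lemma delta_le n : delta n <= INR I * / tau * (LF + LG + track n).
Proof.
rewrite Rmult_assoc -rsum_const; apply: rsum_le => i.
apply: (Rmult_le_reg_l tau) => //; rewrite -Rmult_assoc Rinv_r ?Rmult_1_l; last lra.
exact: dir_le.
Qed.

(** The tolerances enter here through their uniform bound [Meps]; their summability against [alpha]
    serves later, in [error_sum] and [delta_cv0]. *)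
Lemma steps_affine n : steps n <= c3 * (1 + a n + b n).
Proof.
have [x0 xa] := dx_le n; have [y0 yb] := dy_le n; have [t0 tab] := track_le n.
have := steps_le n; have := delta_le n; have := eps_le n; rewrite -/(epss n) => he hd hs.
have It : 0 <= INR I * / tau by apply: Rmult_le_pos; lra.
have := LF_ge0; have := LG_ge0 => LG0 LF0.
have h : LF + LG + track n <= (LF + LG + 1 + L) * (1 + a n + b n).
  have : 0 <= (LF + LG + 1) * a n by apply: Rmult_le_pos; lra.
  have : 0 <= (LF + LG + L) * b n by apply: Rmult_le_pos; lra.
  lra.
have := Rmult_le_compat_l _ _ _ It h; rewrite -Rmult_assoc /c3.
have : 0 <= Meps * (a n + b n) by apply: Rmult_le_pos; lra.
lra.
Qed.

Let c3_ge0 : 0 <= c3.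
Proof.
have := LF_ge0; have := LG_ge0 => LG0 LF0.
have : 0 <= INR I * / tau * (LF + LG + 1 + L) by apply: Rmult_le_pos; [apply: Rmult_le_pos |]; lra.
by rewrite /c3; lra.
Qed.

Let u_ge0 n : 0 <= u n.
Proof. by have := dx_le n; have := dy_le n; rewrite /u; lra. Qed.

Lemma consensus_bounds : (exists M, forall n, u n <= M) /\ bounded_sums (fun n => u n * u n).
Proof.
have cI : 0 <= 2 * c * INR I by apply: Rmult_le_pos; lra.
apply: (@coupled_contraction rho (2 * c * INR I) (2 * c * INR I * L * INR I)
  c3 alpha a b steps) => //.
- by apply: Rmult_le_pos; [apply: Rmult_le_pos | lra].
- by move=> n; have := alpha01 n; lra.
- by move=> n; have := dx_le n; lra.
- by move=> n; have := dy_le n; lra.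
- exact: steps_affine.
- exact: a_rec.
- exact: b_rec.
Qed.

Lemma u_cv0 : Un_cv u 0.
Proof.
apply: Un_cv0_sqr => //; apply: bounded_sums_cv0; last by case: consensus_bounds.
by move=> n; have := u_ge0 n; nra.
Qed.

Lemma alpha_cv0 : Un_cv alpha 0.
Proof.
by apply: Un_cv0_sqr => //; apply: bounded_sums_cv0 => // n; have := alpha_ge0 n; nra.
Qed.

(** [alpha u <= alpha^2 + u^2], which is why square summability of [u] was the target. *)
Lemma alpha_u_sum : bounded_sums (fun n => alpha n * u n).
Proof.
have [_ u2] := consensus_bounds.
apply: bounded_sums_le (bounded_sums_add alpha2_sum u2) => n /=.
have := u_ge0 n; have := alpha_ge0 n; nra.
Qed.

Let dx_le_u n : disagreement (x n) <= u n.
Proof. by have := dx_le n; have := dy_le n; rewrite /u; lra. Qed.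

Let track_le_u n : track n <= (1 + L) * u n.
Proof.
have := track_le n; have := dx_le n; have [y0 yb] := dy_le n.
have : 0 <= L * b n by apply: Rmult_le_pos; lra.
by rewrite /u; lra.
Qed.

Lemma consensus_cv i : Un_cv (fun n => vnorm (vsub (x n i) (xbar n))) 0.
Proof.
apply: Un_cv0_le u_cv0 => n; split; first exact: vnorm_ge0.
exact: Rle_trans (sub_average_le_disagreement _ _) (dx_le_u n).
Qed.

(** Mixing preserves the average, so only the steps move it; its increments do carry the factor
    [alpha]. *)
Lemma xbar_increment n :
  vsub (xbar n.+1) (xbar n) = vscal (alpha n * / INR I) (vsumI (step n)).
Proof.
have -> : xbar n.+1 = vscal (/ INR I) (vsumI (z n)).
  by rewrite -(mix_sum (z n) (W_bist n)) -x_mix.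
apply: functional_extensionality => k; rewrite /average /vsub /vscal.
have -> : vsumI (z n) k = vsumI (x n) k + alpha n * vsumI (step n) k.
  by rewrite -[vsumI (step n) k]/(rsumI _) -rsum_mull -rsum_add; apply: rsum_eq => i; rewrite zE.
by rewrite -[vsumI (fun i => x n i) k]/(vsumI (x n) k); ring.
Qed.

Lemma xbar_increment_le n : vnorm (vsub (xbar n.+1) (xbar n)) <= alpha n * steps n.
Proof.
have iI : 0 < / INR I <= 1.
  split; first by apply: Rinv_0_lt_compat; lra.
  by rewrite -Rinv_1; apply: Rinv_le_contravar; lra.
have ai : 0 <= alpha n * / INR I by apply: Rmult_le_pos; lra || exact: alpha_ge0.
rewrite xbar_increment vnorm_scal_ge0 //.
have := Rmult_le_compat_l _ _ _ ai (vnorm_sum (step n)); rewrite -/(steps n).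
have : 0 <= alpha n * steps n by apply: Rmult_le_pos.
nra.
Qed.

Lemma xbar_path n p : vnorm (vsub (xbar (n + p)%N) (xbar n)) <=
  \rsum_(k < p) (alpha (n + k)%N * steps (n + k)%N).
Proof.
elim: p => [|p IHp]; first by rewrite addn0 vnorm_subvv rsum0; lra.
rewrite (rsum_S (fun k => alpha (n + k)%N * steps (n + k)%N)) addnS.
have := vnorm_sub_triangle (xbar (n + p)%N) (xbar (n + p).+1) (xbar n).
by have := xbar_increment_le (n + p); lra.
Qed.

(** * Descent of the Lyapunov function *)

Lemma F_descent v w : K v -> K w ->
  Rabs (F w - F v - vdot (gradF v) (vsub w v)) <= INR I * L * (vnorm (vsub w v) * vnorm (vsub w v)).
Proof.
move=> Kv Kw; pose r := L * (vnorm (vsub w v) * vnorm (vsub w v)).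
have fi i := lipschitz_grad_descent convexK Kv Kw (grad i) (@lip i) L_ge0.
have sumE : F w - F v - vdot (gradF v) (vsub w v) =
    \rsum_(i < I) (f i w - f i v - vdot (gradf i v) (vsub w v)).
  by rewrite vdot_suml -!rsum_sub.
rewrite sumE Rmult_assoc -/r -rsum_const; apply: Rabs_le; split.
  have -> : - \rsum_(i < I) r = \rsum_(i < I) - r by rewrite !rsum_const; ring.
  apply: rsum_le => i; have := fi i; rewrite -/r; set e := _ - _ => h.
  by have := Rle_abs (- e); rewrite Rabs_Ropp; lra.
apply: rsum_le => i; apply: Rle_trans (fi i); exact: Rle_abs.
Qed.

(* The Lyapunov function averages [G] over the agents rather than evaluating it at [xbar]:
   by double stochasticity [sum G (x_i)] does not increase under mixing, whereas comparing with
   [G xbar] would cost a consensus error without the factor [alpha]. *)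
Let Psi n := INR I * F (xbar n) + \rsum_(i < I) G (x n i).

Lemma G_mixing n : \rsum_(i < I) G (x n.+1 i) <=
  \rsum_(i < I) (G (x n i) + alpha n * (G (xinx n i) - G (x n i))).
Proof.
have [W0 Wr Wc] := W_bist n.
apply: (Rle_trans _ (\rsum_(i < I) \rsum_(j < I) (W n i j * G (z n j)))).
  by apply: rsum_le => i; rewrite xS; apply: convex_jensen.
rewrite rsum_exchange; apply: rsum_le => j; rewrite rsum_mulr Wc Rmult_1_l z_segment.
apply: Rle_trans (convexG _ _ _) _; first by have := alpha01 n; lra.
lra.
Qed.

(** Two replacements in [descent_direction]: [I y_i] by the gradient at the average, at the price of
    [track] times the step, and [xtil] by [xinx], at the price of [eps] times the bounds on [I y_i]
    and on the slope of [G]. *)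
Lemma direction_descent n i :
  vdot (gradF (xbar n)) (step n i) + (G (xinx n i) - G (x n i)) <=
  - (tau * vnorm (dir n i) ^ 2) + track n * vnorm (step n i) + (LF + LG + track n) * eps i n.
Proof.
have stepE : step n i = vadd (dir n i) (vsub (xinx n i) (xtil n i)) by rewrite /step /dir; vec_ring.
have [_ le_eps] := xinxP n i.
have := descent_direction n i.
have := G_lip (xtil n i) (xinx_in n i).
have := cauchy_schwarz (Iy n i) (vsub (xinx n i) (xtil n i)).
have := cauchy_schwarz_opp (vsub (Iy n i) (gradF (xbar n))) (step n i).
have -> : vdot (vsub (Iy n i) (gradF (xbar n))) (step n i) =
  vdot (Iy n i) (dir n i) + vdot (Iy n i) (vsub (xinx n i) (xtil n i))
    - vdot (gradF (xbar n)) (step n i) by rewrite vdot_subl {1}stepE vdot_addr.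
have := Rmult_le_compat_r _ _ _ (vnorm_ge0 (step n i)) (tracking n i).
have : vnorm (Iy n i) * vnorm (vsub (xinx n i) (xtil n i)) <= (LF + track n) * eps i n.
  by apply: Rmult_le_compat; [exact: vnorm_ge0 | exact: vnorm_ge0 | exact: Iy_le | by []].
have : LG * vnorm (vsub (xinx n i) (xtil n i)) <= LG * eps i n.
  by apply: Rmult_le_compat_l => //; exact: LG_ge0.
lra.
Qed.

Lemma Psi_rec n : Psi n.+1 <= Psi n - alpha n * tau * \rsum_(i < I) (vnorm (dir n i) ^ 2)
  + (alpha n * (track n * steps n + (LF + LG + track n) * epss n)
     + INR I * (INR I * L * ((alpha n * steps n) * (alpha n * steps n)))).
Proof.
have := F_descent (xbar_in n) (xbar_in n.+1).
set e := _ - _ => h; have {h} : e <= INR I * L * ((alpha n * steps n) * (alpha n * steps n)).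
  apply: Rle_trans (Rle_abs e) _; apply: Rle_trans h _.
  apply: Rmult_le_compat_l; first by apply: Rmult_le_pos; lra.
  by apply: Rmult_le_compat; try exact: vnorm_ge0; exact: xbar_increment_le.
rewrite /e xbar_increment vdot_scalr vdot_sumr => hF.
have {}hF := Rmult_le_compat_l (INR I) _ _ ltac:(lra) hF.
have := G_mixing n; rewrite rsum_add rsum_mull => hG.
have dirs : \rsum_(i < I) (vdot (gradF (xbar n)) (step n i))
    + \rsum_(i < I) (G (xinx n i) - G (x n i))
  <= - (tau * \rsum_(i < I) (vnorm (dir n i) ^ 2)) + track n * steps n
    + (LF + LG + track n) * epss n.
  rewrite -rsum_add.
  have -> : - (tau * \rsum_(i < I) vnorm (dir n i) ^ 2) + track n * steps n
      + (LF + LG + track n) * epss n =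
   \rsum_(i < I) ((- tau * vnorm (dir n i) ^ 2) + track n * vnorm (step n i)
      + (LF + LG + track n) * eps i n).
    by rewrite !rsum_add !rsum_mull -/(epss n) -/(steps n); ring.
  by apply: rsum_le => i; have := direction_descent n i; lra.
have := Rmult_le_compat_l _ _ _ (alpha_ge0 n) dirs.
move: hF; rewrite /Psi.
set S1 := \rsum_(i < I) (vdot _ _); set S2 := \rsum_(i < I) (G _ - G _) => hF hd.
(* The weight [INR I] of [F] in [Psi] is there for this: the [F] and [G] parts get the same factor
   [alpha]. *)
have cancel : INR I * (alpha n * / INR I * S1) = alpha n * S1 by field; lra.
rewrite -/S2 in hG.
have hF' : INR I * F (xbar n.+1) <= INR I * F (xbar n) + alpha n * S1
   + INR I * (INR I * L * (alpha n * steps n * (alpha n * steps n))).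
  by rewrite -cancel; lra.
lra.
Qed.

Lemma error_sum : bounded_sums (fun n =>
  alpha n * (track n * steps n + (LF + LG + track n) * epss n)
  + INR I * (INR I * L * ((alpha n * steps n) * (alpha n * steps n)))).
Proof.
have [[M HM] _] := consensus_bounds.
have M_ge0 : 0 <= M by apply: Rle_trans (HM 0%N).
have := LF_ge0; have := LG_ge0 => LG0 LF0.
pose R := c3 * (1 + M).
have R_ge0 : 0 <= R by apply: Rmult_le_pos; [exact: c3_ge0 | lra].
have steps_R n : steps n <= R.
  apply: Rle_trans (steps_affine n) _; apply: Rmult_le_compat_l; first exact: c3_ge0.
  by have := HM n; rewrite /u; lra.
have L1 : 0 <= 1 + L by lra.
have trM n : track n <= (1 + L) * M.
  by apply: Rle_trans (track_le_u n) _; apply: Rmult_le_compat_l.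
pose Y := LF + LG + (1 + L) * M.
have Y_ge0 : 0 <= Y by have := Rmult_le_pos _ _ L1 M_ge0; rewrite /Y; lra.
pose Z := INR I * (INR I * L * (R * R)).
have Z_ge0 : 0 <= Z by do !apply: Rmult_le_pos => //; lra.
have := bounded_sums_add (bounded_sums_add
  (bounded_sums_scal (c := (1 + L) * R) ltac:(exact: Rmult_le_pos) alpha_u_sum)
  (bounded_sums_scal Y_ge0 eps_sum)) (bounded_sums_scal Z_ge0 alpha2_sum).
apply: bounded_sums_le => n.
rewrite Rmult_plus_distr_l -/(epss n); apply: Rplus_le_compat; first apply: Rplus_le_compat.
- have -> : (1 + L) * R * (alpha n * u n) = alpha n * ((1 + L) * u n * R) by ring.
  apply: Rmult_le_compat_l => //; apply: Rmult_le_compat => //; first by have := track_le n; lra.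
- have -> : Y * (alpha n * epss n) = alpha n * (Y * epss n) by ring.
  apply: Rmult_le_compat_l => //; apply: Rmult_le_compat_r => //.
  by have := trM n; rewrite /Y; lra.
- have -> : Z * (alpha n * alpha n) = INR I * (INR I * L * ((alpha n * R) * (alpha n * R))).
    by rewrite /Z; ring.
  apply: Rmult_le_compat_l; first lra.
  apply: Rmult_le_compat_l; first by apply: Rmult_le_pos; lra.
  have h : alpha n * steps n <= alpha n * R by apply: Rmult_le_compat_l.
  by apply: Rmult_le_compat => //; apply: Rmult_le_pos.
Qed.

(** Coercivity settles the points far away; on the remaining bounded part, first-order estimates
    around [xbar 0] give an explicit bound. *)
Lemma objective_bounded_below : exists U0, forall v, K v -> U0 <= F v + G v.
Proof.
have [r rP] := coercive 0.
pose p := xbar 0; have Kp : K p := xbar_in 0.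
pose D := Rabs r + vnorm p.
have D_ge0 : 0 <= D by have := Rabs_pos r; have := vnorm_ge0 p; rewrite /D; lra.
pose U0 := F p + G p - (LF * D + INR I * L * (D * D) + LG * D).
exists (Rmin 0 U0) => v Kv.
have [far|near] := Rle_lt_dec r (vnorm v).
  by apply: Rle_trans (rP v Kv far); apply: Rmin_l.
apply: Rle_trans (Rmin_r _ _) _.
have vD : vnorm (vsub v p) <= D.
  by have := vnorm_sub_le v p; have := Rle_abs r; rewrite /D; lra.
have n0 := vnorm_ge0 (vsub v p).
have h : - (INR I * L * (D * D)) <= F v - F p - vdot (gradF p) (vsub v p).
  have := F_descent Kp Kv; set e := _ - _ => he.
  have : Rabs e <= INR I * L * (D * D).
    apply: Rle_trans he _; apply: Rmult_le_compat_l; first by apply: Rmult_le_pos; lra.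
    exact: Rmult_le_compat.
  by have := Rle_abs (- e); rewrite Rabs_Ropp; lra.
have := cauchy_schwarz_opp (gradF p) (vsub v p).
have : vnorm (gradF p) * vnorm (vsub v p) <= LF * D.
  by apply: Rmult_le_compat => //; [exact: vnorm_ge0 | exact: gradF_le].
have := G_lip v Kp; rewrite vnorm_subC.
have : LG * vnorm (vsub v p) <= LG * D by apply: Rmult_le_compat_l => //; exact: LG_ge0.
rewrite /U0; lra.
Qed.

Lemma Psi_ge n : INR I * (F (xbar n) + G (xbar n)) - LG * u n <= Psi n.
Proof.
have h : \rsum_(i < I) (G (xbar n) - LG * vnorm (vsub (x n i) (xbar n))) <= \rsum_(i < I) G (x n i).
  apply: rsum_le => i; have := G_lip (x n i) (xbar_in n).
  by rewrite vnorm_subC; lra.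
rewrite rsum_sub rsum_mull rsum_const in h.
have h2 : LG * \rsum_(i < I) vnorm (vsub (x n i) (xbar n)) <= LG * u n.
  apply: Rmult_le_compat_l; first exact: LG_ge0.
  exact: Rle_trans (sum_sub_average_le _) (dx_le_u n).
by rewrite /Psi; lra.
Qed.

Lemma Psi_telescope : exists P, forall n,
  Psi n + \rsum_(k < n) (alpha k * tau * \rsum_(i < I) (vnorm (dir k i) ^ 2)) <= P.
Proof.
have [M HM] := error_sum; exists (Psi 0 + M) => n.
have := descent_telescope Psi_rec n; have := HM n; lra.
Qed.

Let dirs2_ge0 n : 0 <= \rsum_(i < I) (vnorm (dir n i) ^ 2).
Proof. by apply: rsum_ge0 => i; have := vnorm_ge0 (dir n i); nra. Qed.

Lemma xbar_bounded : exists M, forall n, vnorm (xbar n) <= M.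
Proof.
have [P HP] := Psi_telescope; have [[M HM] _] := consensus_bounds.
(* The level is positive, so that beyond radius [r] the objective is at most [INR I] times
   itself. *)
have [r rP] := coercive (Rabs (P + LG * M) + 1).
exists r => n; apply: Rnot_lt_le => lt_r.
have := rP _ (xbar_in n) (Rlt_le _ _ lt_r); rewrite -/(F (xbar n)) => big_U.
have : 0 <= \rsum_(k < n) (alpha k * tau * \rsum_(i < I) (vnorm (dir k i) ^ 2)).
  by apply: rsum_ge0 => k; apply: Rmult_le_pos => //; apply: Rmult_le_pos => //; lra.
have := HP n; have := Psi_ge n.
have : LG * u n <= LG * M by apply: Rmult_le_compat_l; [exact: LG_ge0 | exact: HM].
have := Rle_abs (P + LG * M); have := Rabs_pos (P + LG * M).
have : 1 * (F (xbar n) + G (xbar n)) <= INR I * (F (xbar n) + G (xbar n)).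
  by apply: Rmult_le_compat_r => //; have := Rabs_pos (P + LG * M); lra.
lra.
Qed.

Lemma delta_sum : bounded_sums (fun n => alpha n * (delta n * delta n)).
Proof.
have [P HP] := Psi_telescope; have [[M HM] _] := consensus_bounds.
have [U0 HU] := objective_bounded_below.
have key : bounded_sums (fun n => alpha n * tau * \rsum_(i < I) (vnorm (dir n i) ^ 2)).
  exists (P - (INR I * U0 - LG * M)) => n.
  have := HP n; have := Psi_ge n.
  have : LG * u n <= LG * M by apply: Rmult_le_compat_l; [exact: LG_ge0 | exact: HM].
  have : INR I * U0 <= INR I * (F (xbar n) + G (xbar n)).
    by apply: Rmult_le_compat_l; [lra | apply: HU; exact: xbar_in].
  lra.
have It : 0 <= INR I * / tau by apply: Rmult_le_pos; lra.
apply: bounded_sums_le (bounded_sums_scal It key) => n.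
have -> : INR I * / tau * (alpha n * tau * \rsum_(i < I) vnorm (dir n i) ^ 2) =
  alpha n * (INR I * \rsum_(i < I) vnorm (dir n i) ^ 2) by field; lra.
apply: Rmult_le_compat_l => //; apply: Rle_trans (square_sum_le _) _; right.
by congr (_ * _); apply: rsum_eq => i; ring.
Qed.

(** * Continuity of the best response and stationarity of limit points *)

(** Each of the two variational inequalities is tested at the other minimizer; in their sum the
    values of [G] cancel. Strong monotonicity is used for the surrogate at [x n i], and [ftil_lip]
    changes the base point to [x p i]. *)
Lemma best_response_lip n p i : tau * vnorm (vsub (xtil p i) (xtil n i)) <=
  L3 * vnorm (vsub (x p i) (x n i)) + vnorm (vsub (pitil p i) (pitil n i)).
Proof.
have Kn := xtil_in n i; have Kp := xtil_in p i; have Kx := x_in n i; have Kx' := x_in p i.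
have vi_n := best_response_variational n i Kp; have vi_p := best_response_variational p i Kn.
have := strongly_monotone_grad convexK tau_gt0 (ftil_sc i Kx) (ftil_grad i Kx Kn)
  (ftil_grad i Kx Kp) Kn Kp.
have := cauchy_schwarz (vsub (gradftil i (xtil p i) (x n i)) (gradftil i (xtil p i) (x p i)))
  (vsub (xtil p i) (xtil n i)).
have := ftil_lip i Kp Kx Kx'; rewrite (vnorm_subC (x n i)).
have := cauchy_schwarz (vsub (pitil n i) (pitil p i)) (vsub (xtil p i) (xtil n i)).
rewrite (vnorm_subC (pitil n i)).
have := vnorm_ge0 (vsub (xtil p i) (xtil n i)); set d := vnorm (vsub (xtil p i) (xtil n i)).
set q1 := vnorm (vsub (gradftil _ _ _) _); set q2 := vnorm (vsub (x p i) _).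
set q3 := vnorm (vsub (pitil p i) _).
move=> d_ge0 cs1 le_lip cs2 mono.
have le_lip2 : q1 * d <= L3 * q2 * d by apply: Rmult_le_compat_r.
have key : tau * d ^ 2 <= d * (L3 * q2 + q3).
  by move: cs1 cs2 mono vi_n vi_p; rewrite !vdotE; lra.
have [d_gt0|<-] := d_ge0.
  by apply: (Rmult_le_reg_l d) => //; lra.
rewrite Rmult_0_r; have : 0 <= L3 * q2 by apply: Rmult_le_pos => //; exact: vnorm_ge0.
by have := vnorm_ge0 (vsub (pitil p i) (pitil n i)); rewrite -/q3; lra.
Qed.

Lemma delta_variation : exists C, 0 <= C /\ forall n p,
  delta p <= delta n + C * (u n + u p + vnorm (vsub (xbar p) (xbar n))).
Proof.
(* The leading 1 is for the motion of [x] in [dir], the rest for that of [xtil]: [L3] from the base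
   point, [1 + L] from tracking, [INR I * L] from the gradient of [F], and a further [L] from the
   local gradient in [pitil]. *)
pose C1 := 1 + / tau * (L3 + (1 + 2 * L) + INR I * L).
have IL : 0 <= INR I * L by apply: Rmult_le_pos; lra.
have C1_ge0 : 0 <= C1.
  have := Rmult_le_pos (/ tau) (L3 + (1 + 2 * L) + INR I * L) ltac:(lra) ltac:(lra).
  by rewrite /C1; lra.
exists (INR I * C1); split; first by apply: Rmult_le_pos; lra.
move=> n p; rewrite Rmult_assoc -rsum_const -rsum_add; apply: rsum_le => i.
set X := u n + u p + _.
have gap : vnorm (vsub (x p i) (x n i)) <= X.
  have := vnorm_sub_triangle (xbar p) (x p i) (x n i).
  have := vnorm_sub_triangle (xbar n) (xbar p) (x n i); rewrite (vnorm_subC (xbar n)).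
  have := sub_average_le_disagreement (x n) i; have := sub_average_le_disagreement (x p) i.
  by have := dx_le_u n; have := dx_le_u p; rewrite /X; lra.
have gapI : vnorm (vsub (Iy p i) (Iy n i)) <= (1 + L) * X + INR I * L * X.
  have := vnorm_sub_triangle (gradF (xbar p)) (Iy p i) (Iy n i).
  have := vnorm_sub_triangle (gradF (xbar n)) (gradF (xbar p)) (Iy n i).
  rewrite (vnorm_subC (gradF (xbar n)) (Iy n i)).
  have := tracking n i; have := tracking p i; have := track_le_u n; have := track_le_u p.
  have := gradF_lip (xbar_in p) (xbar_in n); set D := vnorm (vsub (xbar p) (xbar n)).
  have D0 : 0 <= D := vnorm_ge0 _; have un := u_ge0 n; have up := u_ge0 p.
  have : INR I * L * D <= INR I * L * X by apply: Rmult_le_compat_l => //; rewrite /X -/D; lra.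
  have : (1 + L) * (u n + u p) <= (1 + L) * X.
    by apply: Rmult_le_compat_l; [lra | rewrite /X -/D; lra].
  lra.
have gapP : vnorm (vsub (pitil p i) (pitil n i)) <= (1 + L) * X + INR I * L * X + L * X.
  have -> : vsub (pitil p i) (pitil n i) =
      vsub (vsub (Iy p i) (Iy n i)) (vsub (gradf i (x p i)) (gradf i (x n i))).
    by rewrite !pitilE; vec_ring.
  apply: Rle_trans (vnorm_sub_le _ _) _; apply: Rplus_le_compat => //.
  apply: (Rle_trans _ (L * vnorm (vsub (x p i) (x n i)))); last exact: Rmult_le_compat_l.
  by apply: lip; apply: x_in.
have gapT : vnorm (vsub (xtil p i) (xtil n i)) <= (C1 - 1) * X.
  apply: (Rmult_le_reg_l tau) => //; apply: Rle_trans (best_response_lip n p i) _.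
  have -> : tau * ((C1 - 1) * X) = (L3 + (1 + 2 * L) + INR I * L) * X by rewrite /C1; field; lra.
  have := Rmult_le_compat_l _ _ _ L3_ge0 gap; lra.
have := vnorm_le_add (dir p i) (dir n i).
have -> : vsub (dir p i) (dir n i) = vsub (vsub (xtil p i) (xtil n i)) (vsub (x p i) (x n i)).
  by rewrite /dir; vec_ring.
have := vnorm_sub_le (vsub (xtil p i) (xtil n i)) (vsub (x p i) (x n i)).
lra.
Qed.

Lemma delta_cv0 : Un_cv delta 0.
Proof.
have [C [C_ge0 HC]] := delta_variation.
apply: (@crossing_cv0 C alpha delta u epss) => //;
  [exact: u_cv0 | exact: alpha_cv0 | exact: delta_sum |].
move=> n p; apply: Rle_trans (HC n (n + p)%N) _.
apply: Rplus_le_compat_l; apply: Rmult_le_compat_l => //; apply: Rplus_le_compat_l.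
apply: Rle_trans (xbar_path n p) _; apply: rsum_le => k.
by apply: Rmult_le_compat_l => //; apply: steps_le.
Qed.

Lemma limit_variational xs (phi : nat -> nat) : (forall k, (phi k < phi k.+1)%N) ->
  vconv (fun k => xbar (phi k)) xs ->
  K xs /\ forall w, K w -> 0 <= vdot (gradF xs) (vsub w xs) + (G w - G xs).
Proof.
move=> phi_incr cv_xs.
have phi_ge k : (k <= phi k)%N by elim: k => // k IHk; apply: leq_ltn_trans IHk _.
have Kxs : K xs by apply: closedK cv_xs => k; apply: xbar_in.
(* One agent suffices: its tracker approximates the full gradient, and its best response approaches
   [xs] with the average. *)
split=> // w Kw; pose i := Ordinal I_gt0.
pose h n := delta n + u n + vnorm (vsub (xbar n) xs).
pose C := L3 + L + (1 + L) + INR I * L.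
have IL : 0 <= INR I * L by apply: Rmult_le_pos; lra.
have C_ge0 : 0 <= C by rewrite /C; lra.
have h_ge0 n : 0 <= h n.
  by have := delta_ge0 n; have := u_ge0 n; have := vnorm_ge0 (vsub (xbar n) xs); rewrite /h; lra.
pose nw := vnorm (vsub w xs); have nw_ge0 : 0 <= nw := vnorm_ge0 _.
(* [h n <= 1] keeps [xtil n i] within distance 1 of [xs], hence the factor [nw + 1]. *)
have main n : h n <= 1 ->
    - (h n * (C * (nw + 1) + LF + LG)) <= vdot (gradF xs) (vsub w xs) + (G w - G xs).
  move=> h_le1; have hn0 := h_ge0 n.
  have dn : vnorm (dir n i) <= delta n.
    by apply: (@rsum_ge_term _ (fun i => vnorm (dir n i))) => j; apply: vnorm_ge0.
  have d0 := vnorm_ge0 (dir n i); have un0 := u_ge0 n; have b0 := vnorm_ge0 (vsub (xbar n) xs).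
  have close : vnorm (vsub (xtil n i) xs) <= h n.
    have := vnorm_sub_triangle (x n i) (xtil n i) xs; rewrite -/(dir n i).
    have := vnorm_sub_triangle (xbar n) (x n i) xs.
    have := sub_average_le_disagreement (x n) i; have := dx_le_u n.
    by rewrite /h; lra.
  set A := vadd (gradftil i (xtil n i) (x n i)) (pitil n i).
  have A_close : vnorm (vsub A (gradF xs)) <= C * h n.
    have := vnorm_sub_triangle (Iy n i) A (gradF xs).
    have := vnorm_sub_triangle (gradF (xbar n)) (Iy n i) (gradF xs).
    have := tracking n i; have := track_le_u n; have := gradF_lip (xbar_in n) Kxs.
    have -> : vsub A (Iy n i) = vsub (gradftil i (xtil n i) (x n i)) (gradf i (x n i)).
      by rewrite -gradf_pitil /A; vec_ring.
    have := vnorm_sub_triangle (gradf i (xtil n i)) (gradftil i (xtil n i) (x n i))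
      (gradf i (x n i)).
    have := lip i (xtil_in n i) (x_in n i); rewrite -/(dir n i).
    have := ftil_lip i (xtil_in n i) (x_in n i) (xtil_in n i).
    rewrite ftil_consistent; last exact: xtil_in.
    rewrite (vnorm_subC (x n i)) -/(dir n i).
    have le_h v : v <= delta n \/ v <= u n \/ v <= vnorm (vsub (xbar n) xs) -> v <= h n.
      by have := delta_ge0 n => dl0; case=> [|[|]]; rewrite /h; lra.
    have : L3 * vnorm (dir n i) <= L3 * h n by apply: Rmult_le_compat_l => //; apply: le_h; left.
    have : L * vnorm (dir n i) <= L * h n by apply: Rmult_le_compat_l => //; apply: le_h; left.
    have : (1 + L) * u n <= (1 + L) * h n.
      by apply: Rmult_le_compat_l; [lra | apply: le_h; right; left; right].
    have : INR I * L * vnorm (vsub (xbar n) xs) <= INR I * L * h n.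
      by apply: Rmult_le_compat_l => //; apply: le_h; right; right; right.
    by rewrite /C; lra.
  have vi := best_response_variational n i Kw; rewrite -/A in vi.
  have cs1 := cauchy_schwarz (vsub A (gradF xs)) (vsub w (xtil n i)).
  have cs2 := cauchy_schwarz (gradF xs) (vsub xs (xtil n i)).
  have lipG := G_lip (xtil n i) Kxs.
  rewrite (vnorm_subC xs) in cs2 lipG.
  have far : vnorm (vsub w (xtil n i)) <= nw + 1.
    have := vnorm_sub_triangle xs w (xtil n i); rewrite (vnorm_subC xs) -/nw; lra.
  have e1 : vnorm (vsub A (gradF xs)) * vnorm (vsub w (xtil n i)) <= C * h n * (nw + 1).
    by apply: Rmult_le_compat => //; exact: vnorm_ge0.
  have e2 : vnorm (gradF xs) * vnorm (vsub (xtil n i) xs) <= LF * h n.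
    by apply: Rmult_le_compat => //; [exact: vnorm_ge0 | exact: vnorm_ge0 | exact: gradF_le].
  have e3 : LG * vnorm (vsub (xtil n i) xs) <= LG * h n.
    by apply: Rmult_le_compat_l => //; exact: LG_ge0.
  by move: vi cs1 cs2; rewrite !vdotE; lra.
pose Q := C * (nw + 1) + LF + LG + 1.
have Q_gt0 : 0 < Q.
  have : 0 <= C * (nw + 1) by apply: Rmult_le_pos; lra.
  by have := LF_ge0; have := LG_ge0; rewrite /Q; lra.
apply: le_of_eps => e e_gt0.
pose r := Rmin 1 (e / Q); have r_gt0 : 0 < r by apply: Rmin_glb_lt; [lra | exact: Rdiv_lt_0_compat].
have [N1 HN1] := Un_cv0_eventually delta_cv0 (e := r / 3) ltac:(lra).
have [N2 HN2] := Un_cv0_eventually u_cv0 (e := r / 3) ltac:(lra).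
have [N3 HN3] := Un_cv0_eventually cv_xs (e := r / 3) ltac:(lra).
pose k := (N1 + N2 + N3)%N; pose n := phi k.
have h_r : h n <= r.
  have le1 : (N1 <= n)%N by apply: leq_trans (phi_ge k); rewrite /k -addnA leq_addr.
  have le2 : (N2 <= n)%N by apply: leq_trans (phi_ge k); rewrite /k (addnC N1) -addnA leq_addr.
  have le3 : (N3 <= k)%N by rewrite /k leq_addl.
  have := HN1 n le1; have := HN2 n le2; have := HN3 k le3.
  by rewrite !Rabs_pos_eq //; [rewrite /h /n; lra | exact: vnorm_ge0].
have := main n (Rle_trans _ _ _ h_r (Rmin_l _ _)).
have : h n * Q <= e / Q * Q by apply: Rmult_le_compat_r; [lra | exact: Rle_trans h_r (Rmin_r _ _)].
have -> : e / Q * Q = e by field; lra.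
have := h_ge0 n; rewrite /Q; lra.
Qed.

Lemma next_convergence :
  ((exists M, forall n, vnorm (xbar n) <= M) /\
   (forall (phi : nat -> nat) (xs : vec m),
      (forall k, (phi k < phi k.+1)%N) -> vconv (fun k => xbar (phi k)) xs ->
      stationary K (fun v => gradF v) G xs)) /\
  (forall i, Un_cv (fun n => vnorm (vsub (x n i) (xbar n))) 0).
Proof.
split; last exact: consensus_cv.
split; first exact: xbar_bounded.
move=> phi xs phi_incr cv_xs; have [Kxs opt] := limit_variational phi_incr cv_xs.
by split=> //; apply: subgrad_sum_rule.
Qed.

End Next.

(** * From constants for each agent to common ones *)

Lemma uniform_constant n (P : 'I_n -> R -> Prop) :
  (forall i c c', c <= c' -> P i c -> P i c') -> (forall i, exists c, P i c) ->
  exists c, 0 < c /\ forall i, P i c.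
Proof.
move=> mono exP.
pose c i := proj1_sig (constructive_indefinite_description _ (exP i)).
have cP i : P i (c i) := proj2_sig (constructive_indefinite_description _ (exP i)).
have sum_ge0 : 0 <= \rsum_(i < n) Rabs (c i) by apply: rsum_ge0 => i; apply: Rabs_pos.
exists (1 + \rsum_(i < n) Rabs (c i)); split; first lra.
move=> i; apply: mono (cP i).
have : Rabs (c i) <= \rsum_(i < n) Rabs (c i).
  by apply: (@rsum_ge_term _ (fun i => Rabs (c i))) => j; apply: Rabs_pos.
by have := Rle_abs (c i); lra.
Qed.

Lemma lipschitz_on_le m (K : vec m -> Prop) L L' g : L <= L' ->
  lipschitz_on K L g -> lipschitz_on K L' g.
Proof.
move=> leL lip u v Ku Kv; apply: Rle_trans (lip u v Ku Kv) _.
by apply: Rmult_le_compat_r => //; apply: vnorm_ge0.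
Qed.

Lemma strongly_convex_on_le m (K : vec m -> Prop) tau tau' f : tau' <= tau ->
  strongly_convex_on K tau f -> strongly_convex_on K tau' f.
Proof.
move=> le_tau sc u v t Ku Kv t01; apply: Rle_trans (sc u v t Ku Kv t01) _.
have : 0 <= t * (1 - t) * vnorm (vsub u v) ^ 2.
  by apply: Rmult_le_pos; [nra | apply: pow_le; apply: vnorm_ge0].
nra.
Qed.

Theorem theorem2
  (m I : nat) (HI : (0 < I)%N)
  (* problem data *)
  (K : vec m -> Prop) (f : 'I_I -> vec m -> R) (gradf : 'I_I -> vec m -> vec m)
  (G : vec m -> R)
  (* network *)
  (E : nat -> 'I_I -> 'I_I -> Prop) (W : nat -> 'I_I -> 'I_I -> R)
  (theta : 'I_I -> 'I_I -> R) (vartheta : R)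
  (* surrogates *)
  (ftil : 'I_I -> vec m -> vec m -> R) (gradftil : 'I_I -> vec m -> vec m -> vec m)
  (* algorithm *)
  (alpha : nat -> R) (eps : 'I_I -> nat -> R)
  (x y pitil xtil xinx z : nat -> 'I_I -> vec m)
  (* A1 *)
  (A1 : vnonempty_set K /\ vclosed_set K /\ vconvex_set K)
  (* A2 *)
  (A2 : forall i, C1_near K (f i) (gradf i))
  (* A3 *)
  (A3 : forall i, exists Li, lipschitz_on K Li (gradf i))
  (* A4 *)
  (A4 : exists LF, forall u, K u -> vnorm (vsumI (fun i => gradf i u)) <= LF)
  (* A5 *)
  (A5 : vconvex_fun G /\
        exists LG, forall u xi, K u -> subgrad G u xi -> vnorm xi <= LG)
  (* A6 *)
  (A6 : coercive_on K (fun u => rsumI (fun i => f i u) + G u))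
  (* weights *)
  (Hvartheta : 0 < vartheta < 1)
  (Htheta : forall i j, vartheta <= theta i j <= 1)
  (HW : forall n i j, (in_nbr E n i j -> W n i j = theta i j) /\
                      (~ in_nbr E n i j -> W n i j = 0))
  (* B1 *)
  (B1 : exists B : nat, (0 < B)%N /\ forall k : nat,
          strongly_connected (fun j i => exists n : nat,
             (k * B <= n)%N /\ (n <= (k + 1) * B - 1)%N /\ E n j i))
  (* B2 *)
  (B2 : forall n, (forall i, rsumI (fun j => W n i j) = 1) /\
                  (forall j, rsumI (fun i => W n i j) = 1))
  (* F1 (with differentiability of the surrogate in its first argument) *)
  (F1 : forall i, exists tau, 0 < tau /\ forall u, K u ->
          strongly_convex_on K tau (fun v => ftil i v u))
  (Fdiff : forall i u v, K u -> K v ->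
          has_grad_rel K (fun w => ftil i w u) (gradftil i v u) v)
  (* F2 *)
  (F2 : forall i u, K u -> gradftil i u u = gradf i u)
  (* F3 *)
  (F3 : forall i, exists L3, forall v, K v -> lipschitz_on K L3 (gradftil i v))
  (* initialization *)
  (Hx0 : forall i, K (x 0%N i))
  (Hy0 : forall i, y 0%N i = gradf i (x 0%N i))
  (* pitil[n] = I y[n] - grad f(x[n]) for every n (covers n = 0 and updates) *)
  (Hpi : forall n i, pitil n i = vsub (vscal (INR I) (y n i)) (gradf i (x n i)))
  (* best response *)
  (Hxtil : forall n i, K (xtil n i) /\ forall w, K w ->
      ftil i (xtil n i) (x n i) + vdot (pitil n i) (vsub (xtil n i) (x n i)) + G (xtil n i)
      <= ftil i w (x n i) + vdot (pitil n i) (vsub w (x n i)) + G w)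
  (* inexact solution *)
  (Hxinx : forall n i, K (xinx n i) /\ vnorm (vsub (xinx n i) (xtil n i)) <= eps i n)
  (Hz : forall n i, z n i = vadd (x n i) (vscal (alpha n) (vsub (xinx n i) (x n i))))
  (Hx : forall n i, x (S n) i = vsumI (fun j => vscal (W n i j) (z n j)))
  (Hy : forall n i, y (S n) i =
          vadd (vsumI (fun j => vscal (W n i j) (y n j)))
               (vsub (gradf i (x (S n) i)) (gradf i (x n i))))
  (* tolerances *)
  (Heps : forall i, (forall n, 0 <= eps i n) /\ exists M, forall n, eps i n <= M)
  (* step sizes *)
  (Halpha : forall n, 0 < alpha n <= 1)
  (Hsum : cv_infty (psum alpha))
  (Hsum2 : exists l, Un_cv (psum (fun n => alpha n ^ 2)) l)
  (Hsumeps : forall i, exists l, Un_cv (psum (fun n => alpha n * eps i n)) l) :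
  let xbar := fun n => vscal (/ INR I) (vsumI (fun i => x n i)) in
  ((exists M, forall n, vnorm (xbar n) <= M) /\
   (forall (phi : nat -> nat) (xs : vec m),
      (forall k, (phi k < phi (S k))%N) -> vconv (fun k => xbar (phi k)) xs ->
      stationary K (fun u => vsumI (fun i => gradf i u)) G xs)) /\
  (forall i, Un_cv (fun n => vnorm (vsub (x n i) (xbar n))) 0).
Proof.
have [_ [closedK convexK]] := A1.
have [convexG [LG subgradG_le]] := A5.
have [LF gradF_le] := A4.
have [L [L_gt0 lip]] := uniform_constant
  (fun i c c' le_c => @lipschitz_on_le _ K c c' (gradf i) le_c) A3.
have [L3 [L3_gt0 ftil_lip]] : exists L3, 0 < L3 /\
    forall i v, K v -> lipschitz_on K L3 (gradftil i v).
  apply: uniform_constant F3 => i c c' le_c lip_c v Kv.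
  exact: lipschitz_on_le le_c (lip_c v Kv).
have [T [T_gt0 ftil_sc]] : exists T, 0 < T /\ forall i, exists tau, [/\ 0 < tau, / tau <= T
    & forall u, K u -> strongly_convex_on K tau (fun v => ftil i v u)].
  apply: uniform_constant => [i c c' le_c [tau [tau_gt0 le_T sc]]|i].
    by exists tau; split=> //; lra.
  have [tau [tau_gt0 sc]] := F1 i; exists (/ tau), tau; split=> //; exact: Rle_refl.
have {}ftil_sc i u : K u -> strongly_convex_on K (/ T) (fun v => ftil i v u).
  have [tau [tau_gt0 le_T sc]] := ftil_sc i; move=> Ku.
  apply: strongly_convex_on_le (sc u Ku); rewrite -(Rinv_inv tau).
  by apply: Rinv_le_contravar => //; apply: Rinv_0_lt_compat.
have grad i u : K u -> has_grad (f i) (gradf i u) u.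
  by move=> Ku; have [O [_ [KO [gradO _]]]] := A2 i; apply/gradO/KO.
have W_nbr n i j : in_nbr E n i j -> vartheta <= W n i j.
  by move=> nbr; have [-> // _] := HW n i j; have := Htheta i j; lra.
have W_bist n : bistochastic 1 (W n).
  have [Wr Wc] := B2 n; split=> // i j.
  have [nbr|not_nbr] := classic (in_nbr E n i j); first by have := W_nbr n i j nbr; lra.
  by have [_ ->] := HW n i j; [right|].
have [B [B_gt0 connected]] := B1.
have W_self n i : vartheta <= W n i i by apply: W_nbr; right.
have W_edge n i j : E n j i -> vartheta <= W n i j by move=> Eji; apply: W_nbr; left.
have [rho [c [N [rho01 c_ge0 N_equiv N_add N_mix]]]] :=
  @consensus_norm m I E W vartheta B HI Hvartheta B_gt0 W_bist W_self W_edge connected.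
have alpha_ge0 n : 0 <= alpha n by have := Halpha n; lra.
have eps_ge0 i n : 0 <= eps i n by have [h _] := Heps i.
have [Meps [_ eps_le]] : exists M, 0 < M /\ forall i n, eps i n <= M.
  apply: uniform_constant => [i c1 c2 le_c h n|i]; first exact: Rle_trans (h n) le_c.
  by have [] := Heps i.
apply: (next_convergence (f := f) (ftil := ftil) (gradftil := gradftil) (eps := eps) (L := L)
  (LF := LF) (LG := LG) (tau := / T) (L3 := L3) (Meps := INR I * Meps) (rho := rho) (c := c)
  (N := N) (pitil := pitil) (xtil := xtil) (xinx := xinx) (z := z)) => //; try lra.
- by apply: Rinv_0_lt_compat.
- by move=> n; rewrite -rsum_const; apply: rsum_le => i.
- case=> M HM; have [n0 Hn0] := Hsum M.
  have := Hn0 n0 (le_n n0); rewrite psum_rsum => h; have := HM n0.+1; lra.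
- have [l cv_l] := Hsum2; apply: bounded_sums_le (Un_cv_bounded_sums _ cv_l) => n.
    by right; ring.
  by have := alpha_ge0 n; nra.
- have [M [_ HM]] : exists M, 0 < M /\ forall i : 'I_I, forall p : nat,
      \rsum_(k < p) (alpha k * eps i k) <= M.
    apply: uniform_constant => [i c1 c2 le_c h p|i]; first exact: Rle_trans (h p) le_c.
    have [l cv_l] := Hsumeps i; apply: Un_cv_bounded_sums cv_l => n.
    exact: Rmult_le_pos.
  exists (INR I * M) => p; rewrite -rsum_const.
  rewrite (@rsum_eq _ _ (fun k => \rsum_(i < I) (alpha k * eps i k))).
    by rewrite rsum_exchange; apply: rsum_le => i.
  by move=> k; rewrite rsum_mull.
Qed.
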